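(* Let $X_\phi$ be a substitution tiling system in $\mathbb{R}^m$ with the unique composition property: for every $n\ge 1$, each tiling in $X_\phi$ can be tiled in only one way by supertiles of level $n$. Then there exists $\epsilon_0>0$ such that for all $\epsilon\in(0,\epsilon_0)$ and for almost every tiling $x\in X_\phi$, the group $\mathcal{O}^\epsilon(x)$ is c-equivalent to $\mathcal{O}_j(x)$ for some (and therefore any) tile type $j$. Up to conjugacy in $SO(m)$, $\mathcal{O}_j(x)$ is independent of $x$. Furthermore, if in addition for every $a\in\mathcal{A}$ there exists $n_a>0$ such that $\phi^{n_a}a$ contains a tile of the same type as $a$ and parallel to $a$, then (for such $\epsilon$ and $x$) $\mathcal{O}^\epsilon(x)=\mathcal{O}_j(x)$ for some (and therefore any) tile type $j$.
   Context: $G_E$ is the connected Euclidean group of $\mathbb{R}^m$, the semidirect product of $SO(m)$ with $\mathbb{R}^m$; $g=(r,t)$ denotes the rotation $r$ about the origin followed by translation by $t$, and $T^g$ denotes its action on tiles, patches and tilings. Substitution tiling systems. $\mathcal{A}$ (the alphabet) is a nonempty finite collection of polyhedra in $\mathbb{R}^m$ (polygons if $m=2$), distinct elements not being congruent under $G_E$. A tile is a copy $T^g b$ ($g\in G_E$) of some $b\in\mathcal{A}$; $b$ is its type. $X(\mathcal{A})$ is the set of all tilings of $\mathbb{R}^m$ by tiles. Congruent means congruent under $G_E$. A patch is a (finite or infinite) subset of a tiling in $X(\mathcal{A})$; $W$ is the set of all patches. A substitution function is a map $\phi:W\to W$ which acts simultaneously on all tiles of a patch by subdividing and stretching about the origin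 (so $\phi P=\bigcup_{a\in P}\phi a$), such that: (i) there is a constant $|\phi|>1$ such that $\phi[T^g x]=T^{\phi(g)}\phi x$-equivariance holds in the sense $\phi(T^g x)=T^{\phi(g)}(\phi x)$ for all $g\in G_E$ and patches $x$, where $\phi(g)$ is the conjugate of $g$ by the similarity stretching about the origin by $|\phi|$ (so $\phi((r,t))=(r,|\phi|t)$); (ii) for each tile $a\in\mathcal{A}$ and $n\ge1$, the union of the tiles in $\phi^n a$ is congruent to $|\phi|^n a$, and these tiles meet full face to full face; (iii) for each $a\in\mathcal{A}$, $\phi a$ contains at least one tile of each type. The substitution tiling system $X_\phi\subset X(\mathcal{A})$ (with the action $T$ of $G_E$) is the set of tilings $x$ such that every finite subpatch of $x$ is congruent to a subpatch of $\phi^n a$ for some $n>0$ and $a\in\mathcal{A}$. A patch of the form $\phi^n a$, with $a$ a tile, is a supertile of level $n$. Metric. $X(\mathcal{A})$ carries the metric $d(x,y)=\sup_{n\ge1}\frac1n m_H[B_n(\partial x),B_n(\partial y)]$, where $B_n(\partial x)$ is the intersection of the closed ball $B_n$ of radius $n$ about the origin with the union $\partial x$ of the boundaries of all tiles of $x$, and $m_H$ is Hausdorff distance between compact sets (convention: $0$ between two empty sets, $+\infty$ between an empty and a nonempty set). Parallel: two tiles of the same type are parallel if one is a translate of the other. The groups. For a tiling $x$ and tile $a\in x$ of type $j$, $R_j(a,x)\subset SO(m)$ is the set of rotations bringing some tile of type $j$ in $x$ parallel to $a$; the group it generates does not depend on $a$ and is denoted $\mathcal{O}_j(x)$. For $\epsilon>0$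 and $x\in X_\phi$, $$S^\epsilon(x)=\{y\in X_\phi: d(\phi^n y,\phi^n x)<\epsilon\ \text{for all } n\ge0,\ \text{and } d(\phi^n y,\phi^n x)\to0 \text{ as } n\to\infty\},$$ $$R^\epsilon(x)=\{r\in SO(m): \text{there exists } t \text{ such that } T^{(r,t)}x\in S^\epsilon(x)\},$$ and $\mathcal{O}^\epsilon(x)$ is the subgroup of $SO(m)$ generated by $R^\epsilon(x)$. Two subgroups of $SO(m)$ are c-equivalent if each is conjugate (in $SO(m)$) to a subgroup of the other. ''Almost every $x\in X_\phi$'' means outside a set of measure zero for every translation invariant Borel probability measure on $X_\phi$. *)

(* Defs.v *)
From mathcomp Require Import all_boot all_order all_algebra.
From mathcomp Require Import all_classical all_reals all_analysis.

Set Implicit Arguments.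
Unset Strict Implicit.
Unset Printing Implicit Defensive.

Import Order.TTheory GRing.Theory Num.Theory.
Import numFieldNormedType.Exports.

Local Open Scope classical_set_scope.
Local Open Scope ring_scope.

Section Euclid.
Context {R : realType} {m : nat}.

(* The library norm on 'cV[R]_m is the sup norm; it induces the same topology. *)
Definition enorm (p : 'cV[R]_m) : R := Num.sqrt (\sum_i p i 0 ^+ 2).

Definition eball (r : R) : set 'cV[R]_m := [set p | enorm p <= r].

Definition SO : set 'M[R]_m := [set r | r *m r^T = 1%:M /\ \det r = 1].

Definition SO_subgroup (H : set 'M[R]_m) : Prop :=
  [/\ H `<=` SO, H 1%:M, (forall r s, H r -> H s -> H (r *m s))
    & (forall r, H r -> H (invmx r))].

(* The subgroup of SO(m) generated by a subset of SO(m). *)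
Definition SO_gen (S : set 'M[R]_m) : set 'M[R]_m := smallest SO_subgroup S.

Definition SO_conj (H K : set 'M[R]_m) : Prop :=
  exists2 r, SO r & K = [set r *m h *m invmx r | h in H].

Definition SO_conj_sub (H K : set 'M[R]_m) : Prop :=
  exists L, [/\ SO_subgroup L, L `<=` K & SO_conj H L].

Definition c_equiv (H K : set 'M[R]_m) : Prop :=
  SO_conj_sub H K /\ SO_conj_sub K H.

(* The pair (r, t) stands for the motion p |-> r p + t; it belongs to the
   connected Euclidean group when r is in SO(m). *)
Definition motion : Type := ('M[R]_m * 'cV[R]_m)%type.

Definition GE : set motion := [set g | SO g.1].

Definition move (g : motion) (p : 'cV[R]_m) : 'cV[R]_m := g.1 *m p + g.2.

(* The action T on tiles, and on patches and tilings. *)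
Definition Tt (g : motion) (a : set 'cV[R]_m) : set 'cV[R]_m := move g @` a.

Definition TP (g : motion) (P : set (set 'cV[R]_m)) : set (set 'cV[R]_m) :=
  Tt g @` P.

(* The conjugate of g by the similarity p |-> lam p. *)
Definition conj_dil (lam : R) (g : motion) : motion := (g.1, lam *: g.2).

Definition dilate (lam : R) (a : set 'cV[R]_m) : set 'cV[R]_m :=
  [set lam *: p | p in a].

Definition congruent (a b : set 'cV[R]_m) : Prop := exists2 g, GE g & b = Tt g a.

Definition parallel (a b : set 'cV[R]_m) : Prop := exists t, b = Tt (1%:M, t) a.

Definition chull (s : seq 'cV[R]_m) : set 'cV[R]_m :=
  [set p | exists w : 'I_(size s) -> R,
     [/\ forall i, 0 <= w i, \sum_i w i = 1 & p = \sum_i w i *: s`_i]].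

(* A compact, not necessarily convex, polyhedral set of any dimension. *)
Definition polyhedral (K : set 'cV[R]_m) : Prop :=
  exists ss : seq (seq 'cV[R]_m), K = \bigcup_(s in [set` ss]) chull s.

(* Connectedness of the interior makes a tiling determined by the union of the
   boundaries of its tiles. *)
Definition polyhedron (K : set 'cV[R]_m) : Prop :=
  [/\ polyhedral K, K = closure K°, K° !=set0 & connected K°].

Definition bnd (K : set 'cV[R]_m) : set 'cV[R]_m := closure K `\` K°.

Definition hyperplane (u : 'cV[R]_m) (c : R) : set 'cV[R]_m :=
  [set p | \sum_i u i 0 * p i 0 = c].

(* The interior of F relative to a hyperplane containing it; it is empty when
   there is no such hyperplane or when F has dimension less than m - 1. *)
Definition relint (F : set 'cV[R]_m) : set 'cV[R]_m :=
  [set p | exists u c, [/\ u != 0, F `<=` hyperplane u c, F p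
     & \forall q \near p, hyperplane u c q -> F q]].

Definition face (F : set 'cV[R]_m) : Prop :=
  [/\ polyhedral F, F = closure (relint F), relint F !=set0
    & connected (relint F)].

(* Fs is the set of faces, of dimension m - 1, of the polyhedron K.  As for a
   polygon some of whose angles are straight, a flat piece of the boundary may
   consist of several faces; substitutions such as the pinwheel are face to
   face only with such a choice of faces. *)
Definition faces_of (K : set 'cV[R]_m) (Fs : set (set 'cV[R]_m)) : Prop :=
  [/\ finite_set Fs, (forall F, Fs F -> face F),
      bnd K = \bigcup_(F in Fs) F & trivIset Fs relint].

End Euclid.
Arguments motion : clear implicits.

Section Tilings.
Context {R : realType} {m : nat}.
Local Notation tile := (set 'cV[R]_m).
Local Notation patch := (set (set 'cV[R]_m)).

Variable A : set tile.

Definition has_type (j a : tile) : Prop := A j /\ congruent j a.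

Definition is_tile (a : tile) : Prop := exists j, has_type j a.

(* faces a is the set of faces of the tile a; the polyhedra of the alphabet
   carry a choice of faces, transported by motions. *)
Definition alphabet (faces : tile -> set tile) : Prop :=
  [/\ finite_set A, A !=set0,
      (forall a, A a -> polyhedron a /\ faces_of a (faces a)),
      (forall a b, A a -> A b -> congruent a b -> a = b)
    & (forall a g, A a -> GE g -> faces (Tt g a) = TP g (faces a))].

Definition full_face (faces : tile -> set tile) (P : patch) : Prop :=
  forall a b, P a -> P b -> a <> b ->
  forall F G, faces a F -> faces b G -> relint F `&` relint G !=set0 -> F = G.

Definition tiling (x : patch) : Prop :=
  [/\ (forall a, x a -> is_tile a), \bigcup_(a in x) a = setT
    & trivIset x interior].

Definition is_patch (P : patch) : Prop := exists2 x, tiling x & P `<=` x.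

(* phi is only meaningful on patches; lam is the stretching factor |phi|. *)
Record substitution (faces : tile -> set tile) (phi : patch -> patch) (lam : R)
    : Prop := {
  subst_alphabet : forall a, A a -> is_patch [set a];
  subst_patch : forall P, is_patch P -> is_patch (phi P);
  subst_bigcup : forall P, is_patch P -> phi P = \bigcup_(a in P) phi [set a];
  subst_subdivide : forall a, is_tile a ->
    \bigcup_(b in phi [set a]) b = dilate lam a;
  subst_factor : 1 < lam;
  subst_equiv : forall g P, GE g -> is_patch P ->
    phi (TP g P) = TP (conj_dil lam g) (phi P);
  subst_full_face : forall a n, A a -> (0 < n)%N ->
    congruent (dilate (lam ^+ n) a) (\bigcup_(b in iter n phi [set a]) b) /\
    full_face faces (iter n phi [set a]);
  subst_primitive : forall a j, A a -> A j ->
    exists2 b, phi [set a] b & has_type j b }.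

Section System.
Variable phi : patch -> patch.

Definition Xphi : set patch :=
  [set x | tiling x /\
     forall P, finite_set P -> P `<=` x ->
     exists n a g, [/\ (0 < n)%N, A a, GE g & TP g P `<=` iter n phi [set a]]].

Definition supertile (n : nat) (P : patch) : Prop :=
  exists2 a, is_tile a & P = iter n phi [set a].

Definition supertiling (n : nat) (x : patch) (Q : set patch) : Prop :=
  [/\ (forall P, Q P -> supertile n P), \bigcup_(P in Q) P = x & trivIset Q id].

Definition unique_composition : Prop :=
  forall n x, (0 < n)%N -> Xphi x -> exists! Q, supertiling n x Q.

Definition tiling_bnd (x : patch) : set 'cV[R]_m := \bigcup_(a in x) bnd a.

(* The outer maximum with 0 only matters for two empty sets, and the infimum of
   the empty set is +oo. *)
Definition hausdorff_dist (K L : set 'cV[R]_m) : \bar R :=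
  let dist_to (M : set 'cV[R]_m) p :=
    ereal_inf [set (enorm (p - q))%:E | q in M] in
  maxe 0%E (maxe (ereal_sup [set dist_to L p | p in K])
                 (ereal_sup [set dist_to K q | q in L])).

Definition tdist (x y : patch) : \bar R :=
  ereal_sup [set ((n%:R^-1)%:E *
     hausdorff_dist (eball n%:R `&` tiling_bnd x)
                    (eball n%:R `&` tiling_bnd y))%E | n in [set n | (0 < n)%N]].

(* The open subsets of the metric space Xphi. *)
Definition Xphi_open : set (set patch) :=
  [set U | U `<=` Xphi /\
     forall x, U x -> exists2 e : R, 0 < e &
       forall y, Xphi y -> (tdist x y < e%:E)%E -> U y].

(* A measurable type must be inhabited, which is not known of Xphi: the Borel
   probability measures on Xphi are taken as the probability measures carried
   by Xphi on the type of all patches, for the sigma-algebra generated by the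
   open subsets of Xphi, whose trace on Xphi is the Borel sigma-algebra. *)
Definition invariant_measure
    (mu : probability (g_sigma_algebraType Xphi_open) R) : Prop :=
  mu Xphi = 1%E /\
  forall (t : 'cV[R]_m) (U : set patch), Xphi_open.-sigma.-measurable U ->
    mu (TP (1%:M, t) @` U) = mu U.

(* For all invariant measures simultaneously. *)
Definition null_set (N : set patch) : Prop :=
  Xphi_open.-sigma.-measurable N /\ forall mu, invariant_measure mu -> mu N = 0%E.

Definition almost_every (Q : patch -> Prop) : Prop :=
  exists2 N, null_set N & forall x, Xphi x -> ~ N x -> Q x.

Definition Seps (eps : R) (x : patch) : set patch :=
  [set y | [/\ Xphi y,
     (forall n, (tdist (iter n phi y) (iter n phi x) < eps%:E)%E)
   & tdist (iter n phi y) (iter n phi x) @[n --> \oo] --> 0%E]].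

Definition Reps (eps : R) (x : patch) : set 'M[R]_m :=
  [set r | SO r /\ exists t, Seps eps x (TP (r, t) x)].

Definition Oeps (eps : R) (x : patch) : set 'M[R]_m := SO_gen (Reps eps x).

End System.

Definition Rj (j a : tile) (x : patch) : set 'M[R]_m :=
  [set r | SO r /\ exists b, [/\ x b, has_type j b & parallel (Tt (r, 0) b) a]].

(* The group generated by Rj j a x does not depend on the tile a of type j of
   x: see Oj_indep. *)
Definition Oj (j : tile) (x : patch) : set 'M[R]_m :=
  SO_gen (\bigcup_(a in [set a | x a /\ has_type j a]) Rj j a x).

Definition self_parallel (phi : patch -> patch) : Prop :=
  forall a, A a -> exists n b,
    [/\ (0 < n)%N, iter n phi [set a] b, has_type a b & parallel a b].

End Tilings.

Section OjIndep.
Context {R : realType} {m : nat}.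
Implicit Types (r s : 'M[R]_m) (g h : motion R m) (a b j : set 'cV[R]_m).

Lemma Tt_comp g h a : Tt g (Tt h a) = Tt (g.1 *m h.1, g.1 *m h.2 + g.2) a.
Proof.
rewrite /Tt image_comp; congr (_ @` _); apply/funext => p /=.
by rewrite /move /= mulmxDr mulmxA addrA.
Qed.

Lemma Tt_id a : Tt (1%:M, 0) a = a.
Proof.
rewrite /Tt -[RHS]image_id; congr (_ @` _); apply/funext => p /=.
by rewrite /move /= mul1mx addr0.
Qed.

Lemma SO_unit r : SO r -> r \in unitmx.
Proof. by case=> rr _; case/mulmx1_unit: rr. Qed.

Lemma SO_invE r : SO r -> invmx r = r^T.
Proof.
move=> Sr; have ru := SO_unit Sr; case: Sr => rr _.
by rewrite -[LHS]mulmx1 -rr mulmxA mulVmx // mul1mx.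
Qed.

Lemma SO_subgroupT : SO_subgroup (@SO R m).
Proof.
split=> //.
- by split; rewrite ?trmx1 ?mulmx1 ?det1.
- move=> r s [r1 r2] [s1 s2]; split; last by rewrite det_mulmx r2 s2 mulr1.
  by rewrite trmx_mul mulmxA -(mulmxA r) s1 mulmx1.
- move=> r Sr; rewrite (SO_invE Sr); case: (Sr) => r1 r2.
  by split; [rewrite trmxK; exact: mulmx1C | rewrite det_tr].
Qed.

Lemma SO_gen_subgroup (S : set 'M[R]_m) : S `<=` SO -> SO_subgroup (SO_gen S).
Proof.
move=> SS; split.
- by move=> r; apply; split=> //; exact: SO_subgroupT.
- by move=> H [[]].
- by move=> r s Hr Hs H HS; case: (HS) => -[_ _ + _] _; apply; [exact: Hr|exact: Hs].
- by move=> r Hr H HS; case: (HS) => -[_ _ _ +] _; apply; exact: Hr.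
Qed.

Lemma SO_gen_incl (S : set 'M[R]_m) : S `<=` SO_gen S.
Proof. by move=> r Sr H [_]; exact. Qed.

Lemma parallel_rot r s a b c :
  parallel (Tt (r, 0) a) c -> parallel (Tt (s, 0) b) a ->
  parallel (Tt (r *m s, 0) b) c.
Proof.
move=> [t ->] [u ->]; exists (r *m u + t); rewrite !Tt_comp /=; congr Tt.
by rewrite !mul1mx !mulmx0 !mulmx1 !add0r ?addr0.
Qed.

Lemma has_type_rot (A : set (set 'cV[R]_m)) j a b :
  has_type A j a -> has_type A j b -> exists2 r, SO r & parallel (Tt (r, 0) a) b.
Proof.
move=> [_ [g Gg ->]] [_ [h Gh ->]].
have [SM SV] : (forall r s, SO r -> SO s -> SO (r *m s)) /\
    (forall r, SO r -> SO (invmx r)) by case: SO_subgroupT.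
exists (h.1 *m invmx g.1); first by apply: SM => //; exact: SV.
exists (h.2 - h.1 *m invmx g.1 *m g.2); rewrite !Tt_comp /=.
rewrite !mul1mx add0r addrC subrK -mulmxA mulVmx ?mulmx1; last exact: SO_unit.
by case: h {Gh}.
Qed.

Lemma Oj_indep (A : set (set 'cV[R]_m)) (x : set (set 'cV[R]_m)) j a :
  x a -> has_type A j a -> Oj A j x = SO_gen (Rj A j a x).
Proof.
move=> xa ja.
have RS b : Rj A j b x `<=` SO by move=> r [].
have [SM SV] : (forall r s, SO r -> SO s -> SO (r *m s)) /\
    (forall r, SO r -> SO (@invmx R m r)) by case: SO_subgroupT.
apply/seteqP; split.
- apply: smallest_sub; first exact: SO_gen_subgroup.
  move=> r [b [xb jb] [Sr [c [xc jc rcb]]]].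
  have [q Sq qba] := has_type_rot jb ja.
  have [_ _ GM GV] := SO_gen_subgroup (RS a).
  have Gq : SO_gen (Rj A j a x) q by apply: SO_gen_incl; split=> //; exists b.
  have Gqr : SO_gen (Rj A j a x) (q *m r).
    apply: SO_gen_incl; split; first exact: SM.
    by exists c; split=> //; exact: parallel_rot rcb.
  have -> : r = invmx q *m (q *m r) by rewrite mulmxA mulVmx ?mul1mx ?SO_unit.
  by apply: GM => //; exact: GV.
- apply: smallest_sub; first by apply: SO_gen_subgroup => r [b _ /RS].
  by move=> r Rr; apply: SO_gen_incl; exists a.
Qed.

End OjIndep.

(* Main.v *)
Require Import Defs.
From mathcomp Require Import all_boot all_order all_algebra.
From mathcomp Require Import all_classical all_reals all_analysis.
From mathcomp Require Import ring lra measurable_realfun.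

(* The group O^eps(x) is compared with the groups O_j at both ends.

   Upper bound.  Let y = T^(r,t) x be in S^eps(x) and c a tile of x containing
   the origin.  Nearby tilings have nearby tiles at the origin (a compactness
   argument, run along a free ultrafilter), so y contains T^(s,u) c with (s,u)
   close to the identity.  Applying the substitution n times replaces u by
   lam^n u; as polyhedra have no small symmetries and all the distances remain
   small, lam^n u stays bounded, whence u = 0, and s = 1 since the distances tend
   to 0.  So c is a tile of y, and r is in R_j(c, x).

   Lower bound.  If a supertile P = phi^k a of x = phi^k x' covers a large ball
   about the origin and b = T^g a is a tile of x', then x moved back by the
   dilated g still contains P, hence lies in S^eps(x).  So O_j(x') is contained
   in O^eps(x).

   That P exists for almost every x is shown by averaging: for k large, the
   supertiles of level k divide a bounded grid of translations along boundedly
   many hyperplanes, near which there is a vanishing proportion of the grid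
   points.

   Finally phi maps X_phi onto itself and increases the groups, O_j(x) being
   contained in O_i(phi x); and all patches of x occurring in y up to motions,
   the groups O_j(x) and O_j(y) coincide once x and y have parallel tiles of type
   j. *)

Set Implicit Arguments.
Unset Strict Implicit.
Unset Printing Implicit Defensive.

Import Order.TTheory GRing.Theory Num.Theory.
Import numFieldNormedType.Exports.

Local Open Scope classical_set_scope.
Local Open Scope ring_scope.

(** * Euclidean geometry and motions *)

Section Euclidean.
Context {R : realType} {m : nat}.
Implicit Types (p q u v : 'cV[R]_m) (g h : motion R m) (K L : set 'cV[R]_m).

(** The metric sees only the union of the boundaries of the tiles, so a tile of a nearby tiling has
    to be recovered from boundary points; connectedness of the interiors makes this possible. The
    closeness argument builds no limit tiling: a tile is a prototile with a motion, and motions with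
    bounded translations have ultralimits.

    The lower bound concerns a preimage x' of x, and the type of tile may change along the way.
    Comparing O_j(x') with O_j(x) costs a conjugation, and for m > 2 a subgroup of SO(m) can be
    conjugate to a proper subgroup of itself; so the two inclusions give c-equivalence only.
    Self-parallel tiles make the increasing groups O_j(phi^n x) return to their start, so they are
    constant and no conjugation remains.

    The constant eps0 depends on the shapes of the tiles and on lam alone, whereas the radius rho of
    the ball to be covered depends on eps, and the exceptional set with it. In the averaging, the
    number of hyperplanes depends neither on rho nor on the size n of the grid: n can tend to
    infinity, the level k being chosen after n. *)

Definition dot u v : R := \sum_i u i 0 * v i 0.

Lemma dotC u v : dot u v = dot v u.
Proof. by apply: eq_bigr => i _; rewrite mulrC. Qed.

Lemma dotDl u v p : dot (u + v) p = dot u p + dot v p.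
Proof. by rewrite -big_split; apply: eq_bigr => i _; rewrite mxE mulrDl. Qed.

Lemma dotZl a u v : dot (a *: u) v = a * dot u v.
Proof. by rewrite mulr_sumr; apply: eq_bigr => i _; rewrite mxE mulrA. Qed.

Lemma dotNl u v : dot (- u) v = - dot u v.
Proof. by rewrite -scaleN1r dotZl mulN1r. Qed.

Lemma dotDr u v p : dot p (u + v) = dot p u + dot p v.
Proof. by rewrite dotC dotDl !(dotC p). Qed.

Lemma dotZr a u v : dot u (a *: v) = a * dot u v.
Proof. by rewrite dotC dotZl dotC. Qed.

Lemma dotNr u v : dot u (- v) = - dot u v.
Proof. by rewrite dotC dotNl dotC. Qed.

Lemma dot0l u : dot 0 u = 0.
Proof. by rewrite -(scale0r 0) dotZl mul0r. Qed.

Lemma dot_mulmx (r : 'M[R]_m) u v : dot (r *m u) v = dot u (r^T *m v).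
Proof.
rewrite /dot; under eq_bigr do rewrite mxE mulr_suml.
rewrite exchange_big; apply: eq_bigr => i _; rewrite mxE mulr_sumr.
by apply: eq_bigr => j _; rewrite mxE; ring.
Qed.

Lemma dot_ge0 u : 0 <= dot u u.
Proof. by apply: sumr_ge0 => i _; rewrite -expr2 sqr_ge0. Qed.

Lemma enormE u : enorm u = Num.sqrt (dot u u).
Proof. by congr Num.sqrt; apply: eq_bigr => i _; rewrite expr2. Qed.

Lemma enorm_ge0 u : 0 <= enorm u.
Proof. exact: sqrtr_ge0. Qed.

Lemma sqr_enorm u : enorm u ^+ 2 = dot u u.
Proof. by rewrite enormE sqr_sqrtr ?dot_ge0. Qed.

Lemma enorm0 : enorm (0 : 'cV[R]_m) = 0.
Proof. by rewrite enormE dot0l sqrtr0. Qed.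

Lemma enormZ a u : enorm (a *: u) = `|a| * enorm u.
Proof.
by rewrite !enormE dotZl dotZr mulrA -expr2 sqrtrM ?sqr_ge0 // sqrtr_sqr.
Qed.

Lemma enormN u : enorm (- u) = enorm u.
Proof. by rewrite -scaleN1r enormZ normrN1 mul1r. Qed.

Lemma enormB u v : enorm (u - v) = enorm (v - u).
Proof. by rewrite -enormN opprB. Qed.

Lemma coord_le_enorm u i : `|u i 0| <= enorm u.
Proof.
rewrite -[leRHS]ger0_norm ?enorm_ge0 // -ler_sqr ?nnegrE //.
rewrite !real_normK ?num_real // sqr_enorm /dot (bigD1 i) //= -expr2 lerDl.
by apply: sumr_ge0 => j _; rewrite -expr2 sqr_ge0.
Qed.

Lemma enorm0_eq0 u : enorm u = 0 -> u = 0.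
Proof.
move=> u0; apply/colP => i; apply/eqP; rewrite mxE -normr_le0 -u0.
exact: coord_le_enorm.
Qed.

Lemma cauchy_schwarz u v : dot u v <= enorm u * enorm v.
Proof.
have [->|u0] := eqVneq u 0; first by rewrite dot0l enorm0 mul0r.
have [->|v0] := eqVneq v 0; first by rewrite dotC dot0l enorm0 mulr0.
have up : 0 < enorm u by rewrite lt_neqAle enorm_ge0 andbT eq_sym;
  apply: contra_neq u0 => /enorm0_eq0.
have vp : 0 < enorm v by rewrite lt_neqAle enorm_ge0 andbT eq_sym;
  apply: contra_neq v0 => /enorm0_eq0.
have := dot_ge0 (enorm v *: u - enorm u *: v).
rewrite dotDl !dotDr !dotNl !dotNr !dotZl !dotZr (dotC v u) -!sqr_enorm => H.
have : 0 <= 2 * (enorm u * enorm v) * (enorm u * enorm v - dot u v).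
  by apply: (le_trans H); rewrite le_eqVlt; apply/orP; left; apply/eqP; ring.
by rewrite pmulr_rge0 ?subr_ge0 // !mulr_gt0.
Qed.

Lemma enormD u v : enorm (u + v) <= enorm u + enorm v.
Proof.
rewrite -ler_sqr ?nnegrE ?addr_ge0 ?enorm_ge0 //.
rewrite sqr_enorm dotDl !dotDr (dotC v u) -!sqr_enorm.
by have := cauchy_schwarz u v; lra.
Qed.

Lemma enorm_tri p q u : enorm (p - u) <= enorm (p - q) + enorm (q - u).
Proof. by rewrite (le_trans _ (enormD _ _)) // addrA subrK. Qed.

Lemma enorm_le_sum u : enorm u <= \sum_i `|u i 0|.
Proof.
rewrite -ler_sqr ?nnegrE ?enorm_ge0 ?sumr_ge0 // sqr_enorm expr2 mulr_suml.
apply: ler_sum => i _; apply: (le_trans (ler_norm _)); rewrite normrM.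
by rewrite ler_wpM2l // (bigD1 i) //= lerDl sumr_ge0.
Qed.

Lemma enorm_SO (r : 'M[R]_m) u : SO r -> enorm (r *m u) = enorm u.
Proof.
by move=> [/mulmx1C rr _]; rewrite !enormE dot_mulmx mulmxA rr mul1mx.
Qed.

Lemma nbhs_enormP p (W : set 'cV[R]_m) :
  nbhs p W <-> exists2 e : R, 0 < e & forall q, enorm (q - p) < e -> W q.
Proof.
split.
- move=> /nbhs_ballP [e /= e0 eW]; exists e => // q qe; apply: eW.
  split=> // i j; rewrite (ord1 j) /ball /= distrC; apply: le_lt_trans qe.
  by have := coord_le_enorm (q - p) i; rewrite !mxE.
(* The bound on one coordinate is added up [m] times; [m.+1] keeps the total strictly below [e] and
   also serves in dimension 0. *)
- move=> [e e0 eW]; apply/nbhs_ballP; exists (e / m.+1%:R) => /=.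
    by rewrite divr_gt0 // ltr0n.
  move=> q [_ pq]; apply: eW; apply: le_lt_trans (enorm_le_sum _) _.
  apply: (@le_lt_trans _ _ (\sum_(i < m) (e / m.+1%:R))).
    apply: ler_sum => i _; have := pq i 0; rewrite /ball /= !mxE distrC.
    exact: ltW.
  rewrite sumr_const card_ord -[_ *+ m]mulr_natr mulrAC -mulrA -[ltRHS]mulr1.
  by rewrite ltr_pM2l // ltr_pdivrMr ?ltr0n // mul1r ltr_nat.
Qed.

Lemma interior_enormP K p :
  K° p <-> exists2 e : R, 0 < e & forall q, enorm (q - p) < e -> K q.
Proof. exact: nbhs_enormP. Qed.

Lemma closure_enormP K p :
  closure K p <-> forall e : R, 0 < e -> exists2 q, K q & enorm (q - p) < e.
Proof.
split=> [cl e e0|cl W /nbhs_enormP [e e0 eW]].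
  have /cl [q [Kq qe]] : nbhs p [set q | enorm (q - p) < e] by
    apply/nbhs_enormP; exists e.
  by exists q.
by have [q Kq /eW] := cl e e0; exists q.
Qed.

(** If [C] missed [bnd K], its traces on [K°] and on [closure K] would coincide, and this set would
    be clopen in [C], nonempty and proper. *)
Lemma connected_meets_bnd (C K : set 'cV[R]_m) p q :
  connected C -> C p -> K p -> C q -> ~ K q -> exists2 z, C z & bnd K z.
Proof.
move=> cC Cp Kp Cq nKq; apply: contrapT => nb.
have sub z : C z -> closure K z -> K° z.
  by move=> Cz clz; apply: contrapT => nKz; apply: nb; exists z.
have : C `&` K° = C.
  apply: cC; first by exists p; split=> //; apply: sub => //; exact: subset_closure.
    by exists K° => //; exact: open_interior.
  exists (closure K); first exact: closed_closure.
  apply/seteqP; split=> z [Cz Kz]; split=> //; last exact: sub.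
  by apply: subset_closure; exact: interior_subset Kz.
by move=> E; move: Cq; rewrite -E => -[_ /interior_subset].
Qed.

Lemma segment_meets_bnd K p q : K p -> ~ K q ->
  exists z, bnd K z /\ enorm (z - p) <= enorm (q - p).
Proof.
move=> Kp nKq; pose f (s : R) := p + s *: (q - p).
have cf : continuous f.
  move=> s W /nbhs_enormP [e e0 eW].
  apply/nbhs_ballP; exists (e / (enorm (q - p) + 1)) => /=.
    by rewrite divr_gt0 // ltr_wpDl ?enorm_ge0.
  move=> s' ss'; apply: eW; rewrite /f opprD addrACA subrr add0r -scalerBl enormZ.
  have : `|s' - s| < e / (enorm (q - p) + 1) by rewrite distrC.
  rewrite ltr_pdivlMr ?ltr_wpDl ?enorm_ge0 //; apply: le_lt_trans.
  by rewrite ler_wpM2l // lerDl.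
have cC : connected (f @` `[0, 1]).
  apply: connected_continuous_connected; first exact: segment_connected.
  exact: continuous_subspaceT.
have [||z [s s01 <-] bz] := @connected_meets_bnd _ K p q cC _ Kp _ nKq.
- by exists 0; rewrite /= ?in_itv /= ?lexx ?ler01 // /f scale0r addr0.
- by exists 1; rewrite /= ?in_itv /= ?lexx ?ler01 // /f scale1r addrC subrK.
exists (f s); split=> //; move: s01; rewrite /= in_itv /= => /andP[s0 s1].
rewrite /f addrAC subrr add0r enormZ ger0_norm //.
by rewrite -[leRHS]mul1r ler_wpM2r // enorm_ge0.
Qed.

(** * The group of motions and its action on sets *)

Definition gmul g h : motion R m := (g.1 *m h.1, g.1 *m h.2 + g.2).
Definition ginv g : motion R m := (g.1^T, - (g.1^T *m g.2)).

Lemma SO_mul (r s : 'M[R]_m) : SO r -> SO s -> SO (r *m s).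
Proof. by case: (@SO_subgroupT R m) => _ _ + _; apply. Qed.

Lemma SO_tr (r : 'M[R]_m) : SO r -> SO r^T.
Proof. by move=> Sr; rewrite -SO_invE //; case: (@SO_subgroupT R m) => _ _ _;
  apply. Qed.

Lemma SO_1 : SO (1%:M : 'M[R]_m).
Proof. by case: (@SO_subgroupT R m). Qed.

Lemma SO_mulVmx (r : 'M[R]_m) : SO r -> r^T *m r = 1%:M.
Proof. by case=> /mulmx1C. Qed.

Lemma SO_mulmxV (r : 'M[R]_m) : SO r -> r *m r^T = 1%:M.
Proof. by case. Qed.

Lemma GE_mul g h : GE g -> GE h -> GE (gmul g h).
Proof. exact: SO_mul. Qed.

Lemma GE_inv g : GE g -> GE (ginv g).
Proof. exact: SO_tr. Qed.

Lemma move_mul g h p : move (gmul g h) p = move g (move h p).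
Proof. by rewrite /move /= mulmxDr mulmxA addrA. Qed.

Lemma gmulKV g : GE g -> gmul g (ginv g) = (1%:M, 0).
Proof.
move=> Gg; rewrite /gmul /= SO_mulmxV // mulmxN mulmxA SO_mulmxV //.
by rewrite mul1mx addNr.
Qed.

Lemma gmulVK g : GE g -> gmul (ginv g) g = (1%:M, 0).
Proof. by move=> Gg; rewrite /gmul /= SO_mulVmx // subrr. Qed.

Lemma moveK g : GE g -> cancel (move g) (move (ginv g)).
Proof. by move=> Gg p; rewrite -move_mul gmulVK // /move /= mul1mx addr0. Qed.

Lemma moveVK g : GE g -> cancel (move (ginv g)) (move g).
Proof. by move=> Gg p; rewrite -move_mul gmulKV // /move /= mul1mx addr0. Qed.

Lemma move_iso g p q : GE g -> enorm (move g p - move g q) = enorm (p - q).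
Proof.
by move=> Gg; rewrite /move opprD addrACA subrr addr0 -mulmxBr enorm_SO.
Qed.

Lemma Tt_mul g h K : Tt g (Tt h K) = Tt (gmul g h) K.
Proof. exact: Tt_comp. Qed.

Lemma TtK g K : GE g -> Tt (ginv g) (Tt g K) = K.
Proof. by move=> Gg; rewrite Tt_mul gmulVK // Tt_id. Qed.

Lemma TtE g K p : GE g -> Tt g K p <-> K (move (ginv g) p).
Proof.
move=> Gg; split=> [[q Kq <-]|Kp]; first by rewrite moveK.
by exists (move (ginv g) p) => //; rewrite moveVK.
Qed.

Lemma Tt_interior g K : GE g -> (Tt g K)° = Tt g K°.
Proof.
move=> Gg; have Gi := GE_inv Gg; apply/seteqP; split=> p.
- move=> /interior_enormP [e e0 He]; apply/TtE => //; apply/interior_enormP;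
  exists e => // q qe.
  have : Tt g K (move g q).
    by apply: He; rewrite -[p](moveVK Gg) move_iso.
  by move/TtE; rewrite moveK //; apply.
- move=> /TtE -/(_ Gg)/interior_enormP [e e0 He]; apply/interior_enormP;
  exists e => // q qe.
  by apply/TtE => //; apply: He; rewrite move_iso.
Qed.

Lemma Tt_closure g K : GE g -> closure (Tt g K) = Tt g (closure K).
Proof.
move=> Gg; have Gi := GE_inv Gg; apply/seteqP; split=> p.
- move=> /closure_enormP He; apply/TtE => //; apply/closure_enormP => e e0.
  have [q /TtE -/(_ Gg) Kq qe] := He e e0.
  by exists (move (ginv g) q) => //; rewrite move_iso.
- move=> /TtE -/(_ Gg)/closure_enormP He; apply/closure_enormP => e e0.
  have [q Kq qe] := He e e0; exists (move g q); first by exists q.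
  by rewrite -[p](moveVK Gg) move_iso.
Qed.

Lemma Tt_bnd g K : GE g -> bnd (Tt g K) = Tt g (bnd K).
Proof.
move=> Gg; rewrite /bnd Tt_interior // Tt_closure //; apply/seteqP; split=> p.
  by move=> [/TtE -/(_ Gg) a b]; apply/TtE => //; split=> // c; apply: b; apply/TtE.
by move=> /TtE -/(_ Gg) [a b]; split; [apply/TtE|move/TtE => /(_ Gg)].
Qed.

Lemma move_continuous g : GE g -> continuous (move g).
Proof.
move=> Gg p W /nbhs_enormP [e e0 eW]; apply/nbhs_enormP; exists e => // q qe.
by apply: eW; rewrite move_iso.
Qed.

Lemma Tt_connected g K : GE g -> connected K -> connected (Tt g K).
Proof.
move=> Gg cK; apply: connected_continuous_connected => //.
exact: continuous_subspaceT (move_continuous Gg).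
Qed.

Lemma TP_mul g h (P : set (set 'cV[R]_m)) : TP g (TP h P) = TP (gmul g h) P.
Proof.
rewrite /TP image_comp; congr (_ @` _); apply/funext => a /=; exact: Tt_mul.
Qed.

Lemma TP_id (P : set (set 'cV[R]_m)) : TP (1%:M, 0) P = P.
Proof.
by rewrite /TP -[RHS]image_id; congr (_ @` _); apply/funext => a; exact: Tt_id.
Qed.

Lemma TPK g (P : set (set 'cV[R]_m)) : GE g -> TP (ginv g) (TP g P) = P.
Proof. by move=> Gg; rewrite TP_mul gmulVK // TP_id. Qed.

Lemma TP_set1 g K : TP g [set K] = [set Tt g K].
Proof. exact: image_set1. Qed.

Lemma gmulA (g h k : motion R m) : gmul g (gmul h k) = gmul (gmul g h) k.
Proof. by rewrite /gmul /= mulmxDr !mulmxA addrA. Qed.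

Lemma gmul1 g : gmul (1%:M, 0) g = g.
Proof. by case: g => r t; rewrite /gmul /= !mul1mx addr0. Qed.

Lemma gmulg1 g : gmul g (1%:M, 0) = g.
Proof. by case: g => r t; rewrite /gmul /= mulmx1 mulmx0 add0r. Qed.

Lemma GE1 : GE ((1%:M, 0) : motion R m).
Proof. exact: SO_1. Qed.

End Euclidean.

(** * Polyhedral sets *)

(** Turns one constant per prototile into one for the whole alphabet. As [P] has to pass to smaller
    [e], upper bounds such as diameters are fed to it through [e^-1]. *)
Lemma finite_uniform (R : realType) (T : choiceType) (A : set T) (P : T -> R ->
  Prop) :
  finite_set A -> (forall a e e', 0 < e' <= e -> P a e -> P a e') ->
  (forall a, A a -> exists2 e, 0 < e & P a e) ->
  exists2 e, 0 < e & forall a, A a -> P a e.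
Proof.
move=> /finite_seqP [s ->] Pmono; elim: s => [|a s IH] H; first by exists 1.
have [|e e0 He] := IH; first by move=> b bs; apply: H; rewrite /= inE bs orbT.
have [|e' e'0 He'] := H a; first by rewrite /= inE eqxx.
exists (Num.min e e'); first by rewrite lt_min e0 e'0.
move=> b; rewrite /= inE => /orP[/eqP ->|bs].
  by apply: Pmono He'; rewrite lt_min e0 e'0 ge_min lexx orbT.
by apply: Pmono (He b bs); rewrite lt_min e0 e'0 ge_min lexx.
Qed.

Lemma seq_argmax (R : realType) (T : eqType) (f : T -> R) (s : seq T) :
  s != [::] -> exists2 x, x \in s & forall y, y \in s -> f y <= f x.
Proof.
elim: s => [//|a s IH] _; have [->|s0] := eqVneq s [::].
  by exists a; rewrite ?inE // => y; rewrite inE => /eqP ->.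
have [x xs Hx] := IH s0; have [ax|xa] := leP (f a) (f x).
  exists x; first by rewrite inE xs orbT.
  by move=> y; rewrite inE => /orP[/eqP ->|/Hx].
exists a; first by rewrite inE eqxx.
move=> y; rewrite inE => /orP[/eqP -> //|/Hx yx].
exact: le_trans yx (ltW xa).
Qed.

Section Polyhedra.
Context {R : realType} {m : nat}.
Implicit Types (p q u v : 'cV[R]_m) (g h : motion R m) (K L : set 'cV[R]_m).

Lemma enorm_sum (I : finType) (f : I -> 'cV[R]_m) :
  enorm (\sum_i f i) <= \sum_i enorm (f i).
Proof.
elim/big_ind2: _ => [|a u b v H H'|//]; first by rewrite enorm0.
by rewrite (le_trans (enormD _ _)) // lerD.
Qed.

Lemma dot_suml (I : finType) (f : I -> 'cV[R]_m) v :
  dot (\sum_i f i) v = \sum_i dot (f i) v.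
Proof.
by elim/big_ind2: _ => [|a u b w <- <-|//]; rewrite ?dot0l ?dotDl.
Qed.

Lemma chull_vertex (s : seq 'cV[R]_m) v : v \in s -> chull s v.
Proof.
move=> vs; have vi : (index v s < size s)%N by rewrite index_mem.
exists (fun i => (i == Ordinal vi)%:R); split.
- by move=> i; rewrite ler0n.
- by rewrite (bigD1 (Ordinal vi)) //= eqxx big1 ?addr0 // => i /negPf ->.
- rewrite (bigD1 (Ordinal vi)) //= eqxx big1 ?addr0 ?scale1r ?nth_index //.
  by move=> i /negPf ->; rewrite scale0r.
Qed.

Lemma chull_enorm_le (s : seq 'cV[R]_m) q (d : R) p :
  (forall v, v \in s -> enorm (v - q) <= d) -> chull s p -> enorm (p - q) <= d.
Proof.
move=> Hd [w [w0 w1 ->]].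
have -> : \sum_i w i *: s`_i - q = \sum_i w i *: (s`_i - q).
  under [RHS]eq_bigr do rewrite scalerBr.
  by rewrite big_split /= sumrN -scaler_suml w1 scale1r.
apply: (le_trans (enorm_sum _)); rewrite -[leRHS]mul1r -w1 mulr_suml.
apply: ler_sum => i _; rewrite enormZ ger0_norm // ler_wpM2l // Hd //.
by rewrite mem_nth.
Qed.

(* Parallel axis identity: the weighted mean of |s_i - q|^2 exceeds |p - q|^2
   by the weighted mean of |s_i - p|^2. *)
Lemma chull_farthest (s : seq 'cV[R]_m) q p : chull s p ->
  (forall v, v \in s -> enorm (v - q) <= enorm (p - q)) -> p \in s.
Proof.
move=> [w [w0 w1 pE]] Hf.
have Hs : \sum_i w i * enorm (s`_i - p) ^+ 2 <= 0.
  have E : \sum_i w i * enorm (s`_i - q) ^+ 2 =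
      enorm (p - q) ^+ 2 + \sum_i w i * enorm (s`_i - p) ^+ 2.
    apply/eqP; rewrite -subr_eq -sumrB; apply/eqP.
    under eq_bigr => i _.
      have -> : w i * enorm (s`_i - q) ^+ 2 - w i * enorm (s`_i - p) ^+ 2 =
         dot (w i *: s`_i) (2 *: (p - q)) + w i * (dot q q - dot p p).
        rewrite !sqr_enorm !(dotDl, dotDr, dotNl, dotNr, dotZl, dotZr).
        by rewrite (dotC p) (dotC q); ring.
      over.
    rewrite big_split /= -dot_suml -mulr_suml w1 -pE.
    rewrite !sqr_enorm !(dotDl, dotDr, dotNl, dotNr, dotZl, dotZr).
    by rewrite (dotC q p); ring.
  have : \sum_i w i * enorm (s`_i - q) ^+ 2 <= enorm (p - q) ^+ 2.
    rewrite -[leRHS]mul1r -w1 mulr_suml; apply: ler_sum => i _.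
    rewrite ler_wpM2l // lerXn2r ?nnegrE ?enorm_ge0 // Hf // mem_nth //.
  by rewrite E gerDl.
have H0 i : w i * enorm (s`_i - p) ^+ 2 = 0.
  have : \sum_i w i * enorm (s`_i - p) ^+ 2 = 0.
    by apply/eqP; rewrite eq_le Hs sumr_ge0 // => j _; rewrite mulr_ge0 ?sqr_ge0.
  by move/psumr_eq0P => -> // j _; rewrite mulr_ge0 ?sqr_ge0.
have [i wi] : exists i, w i != 0.
  apply: contrapT => /forallNP nw; move: w1; rewrite big1 => [/eqP|i _].
    by rewrite eq_sym oner_eq0.
  by have /negP := nw i; rewrite negbK => /eqP.
have /eqP := H0 i; rewrite mulf_eq0 (negPf wi) /= sqrf_eq0 => /eqP /enorm0_eq0.
by move/eqP; rewrite subr_eq0 => /eqP <-; rewrite mem_nth.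
Qed.

(** A point of [K] farthest from [q] is farthest in its own hull, hence one of the listed points of
    that hull. The finite list [S] thus serves all centres [q] at once. *)
Lemma polyhedral_vertices K : polyhedral K ->
  exists2 S : seq 'cV[R]_m, {subset S <= K} &
    (forall q, K !=set0 -> exists2 p, K p & forall p',
      K p' -> enorm (p' - q) <= enorm (p - q)) /\
    (forall q p, K p -> (forall p',
      K p' -> enorm (p' - q) <= enorm (p - q)) -> p \in S).
Proof.
move=> [ss ->]; exists (flatten ss).
  by move=> v /flattenP [s sss vs]; rewrite inE; exists s => //; exact: chull_vertex.
have vK s v : s \in ss -> v \in s -> (\bigcup_(s in [set` ss]) chull s) v.
  by move=> sss vs; exists s => //; exact: chull_vertex.
split=> q.
- move=> [p0 [s0 s0s p0s]].
  have S0 : flatten ss != [::].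
    have : s0 != [::].
      apply/eqP => s0E; case: p0s; rewrite s0E => w [_ + _].
      by rewrite big_ord0 => /eqP; rewrite eq_sym oner_eq0.
    case: s0 s0s {p0s} => [//|v s0] s0s _; apply/eqP => E.
    have : v \in flatten ss by apply/flattenP; exists (v :: s0); rewrite ?inE ?eqxx.
    by rewrite E.
  have [p /flattenP [s sss ps] pmax] := seq_argmax (fun v => enorm (v - q)) S0.
  exists p; first exact: vK sss ps.
  move=> p' [s' s's]; apply: chull_enorm_le => v vs; apply: pmax.
  by apply/flattenP; exists s'.
- move=> p [s sss ps] pmax; apply/flattenP; exists s => //.
  apply: chull_farthest ps _ => v vs; apply: pmax; exact: vK sss vs.
Qed.

Lemma polyhedral_bounded K : polyhedral K -> exists2 D : R, 0 < D & forall p,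
  K p -> enorm p <= D.
Proof.
move=> /polyhedral_vertices [S _ [far _]].
have [->|/set0P K0] := eqVneq K set0; first by exists 1.
have [p Kp pmax] := far 0 K0; exists (enorm p + 1).
  by rewrite ltr_wpDl ?enorm_ge0.
by move=> p' /pmax; rewrite !subr0 => /le_trans; apply; rewrite lerDl.
Qed.

Lemma seq_separated (S : seq 'cV[R]_m) :
  exists2 d : R, 0 < d & forall v w,
    v \in S -> w \in S -> enorm (v - w) < d -> v = w.
Proof.
have fS : finite_set [set` S] by exact: finite_seq.
have [||d d0 Hd] := @finite_uniform R _ [set` S]
    (fun v d => forall w, w \in S -> enorm (v - w) < d -> v = w) fS.
- by move=> a e e' /andP[_ ee] H w /H + we; apply; exact: lt_le_trans ee.
- move=> v vS; have [||d d0 Hd] := @finite_uniform R _ [set` S]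
    (fun w d => enorm (v - w) < d -> v = w) fS.
  + by move=> a e e' /andP[_ ee] + we; apply; exact: lt_le_trans ee.
  + move=> w wS; have [->|vw] := eqVneq v w; first by exists 1.
    exists (enorm (v - w)); last by rewrite ltxx.
    rewrite lt_neqAle enorm_ge0 andbT eq_sym;
      apply: contra_neq vw => /enorm0_eq0 /eqP.
    by rewrite subr_eq0 => /eqP.
  by exists d.
by exists d => // v w vS wS; exact: Hd.
Qed.

(* The points of K farthest from some point are among the vertices, and they
   affinely span: seen from p0 - L u with L large, the farthest point of K lies
   beyond p0 in the direction u. *)
Lemma polyhedral_rigid K : polyhedral K -> K° !=set0 ->
  exists2 d : R, 0 < d & forall g, GE g -> Tt g K = K ->
    (forall p, K p -> enorm (move g p - p) < d) -> g = (1%:M, 0).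
Proof.
move=> pK [p1 Kp1].
have [D D0 HD] := polyhedral_bounded pK.
have [S SK [far farS]] := polyhedral_vertices pK.
have [d d0 Hd] := seq_separated S; exists d => // g Gg gK gd.
have Kp1' := interior_subset Kp1.
(* [g] carries a point farthest from [q] to one farthest from [move g q]. Both are in [S] and closer
   than the separation [d], so they are equal. *)
have fixE q p : K p -> (forall p', K p' -> enorm (p' - q) <= enorm (p - q)) ->
    move g p = p.
  move=> Kp pmax; have Kg p' : K p' -> K (move g p') by rewrite -{2}gK => Kp';
    exists p'.
  apply: Hd; [|exact: farS Kp pmax|exact: gd].
  apply: (farS (move g q)); first exact: Kg.
  move=> p'; rewrite -{1}gK => -[p'' Kp'' <-]; rewrite !move_iso //; exact: pmax.
have g1 : g.1 = 1%:M.
  apply: contrapT => /eqP; rewrite -subr_eq0 => /eqP ng.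
  have [i [j ij]] : exists i j, (g.1 - 1%:M) i j != 0.
    apply: contrapT => nn; apply: ng; apply/matrixP => i j; rewrite [RHS]mxE.
    by apply: contrapT => /eqP nij; apply: nn; exists i, j.
  (* Fixed points solve [(g.1 - 1%:M) *m p = - g.2]; a nonzero row of this system puts all farthest
     points in one hyperplane. *)
  pose v : 'cV[R]_m := \col_k (g.1 - 1%:M) i k.
  pose c : R := - g.2 i 0.
  have vE q p : K p -> (forall p',
    K p' -> enorm (p' - q) <= enorm (p - q)) -> dot v p = c.
    move=> Kp pmax; have := fixE q p Kp pmax; rewrite /move => E.
    have : (g.1 - 1%:M) *m p = - g.2.
      rewrite mulmxBl mul1mx; apply/eqP; rewrite subr_eq addrC -subr_eq opprK.
      exact/eqP.
    move/matrixP => /(_ i 0); rewrite [RHS]mxE /c => <-; rewrite mxE.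
    by apply: eq_bigr => k _; rewrite mxE.
  have vv : 0 < dot v v.
    rewrite lt_neqAle dot_ge0 andbT eq_sym -sqr_enorm sqrf_eq0.
    apply/eqP => /enorm0_eq0 /matrixP /(_ j 0); rewrite !mxE => /eqP.
    by move: ij; rewrite !mxE => /negP.
  have [p0 Kp0 vp0] : exists2 p0, K p0 & dot v p0 != c.
    have [vp1|] := eqVneq (dot v p1) c; last by exists p1.
    have [e e0 He] := (interior_enormP _ _).1 Kp1.
    have vn : 0 < enorm v.
      by rewrite lt_neqAle enorm_ge0 andbT eq_sym -sqrf_eq0 sqr_enorm gt_eqF.
    exists (p1 + (e / 2 / enorm v) *: v).
      apply: He; rewrite addrAC subrr add0r enormZ ger0_norm.
        by rewrite mulfVK ?gt_eqF //; lra.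
      by rewrite !divr_ge0 // ltW.
    rewrite dotDr dotZr vp1 -subr_eq0 addrAC subrr add0r mulf_neq0 ?gt_eqF //.
    by rewrite !divr_gt0.
  pose w := if dot v p0 < c then - v else v.
  pose c' := if dot v p0 < c then - c else c.
  have wE q p : K p -> (forall p',
    K p' -> enorm (p' - q) <= enorm (p - q)) -> dot w p = c'.
    by move=> Kp /(vE _ _ Kp) E; rewrite /w /c'; case: ifP => _; rewrite ?dotNl E.
  have wp0 : 0 < dot w p0 - c'.
    rewrite /w /c'; case: (ltP (dot v p0) c) => H; rewrite ?dotNl; first lra.
    by rewrite subr_gt0 lt_neqAle eq_sym vp0.
  (* Since [p] lies in the hyperplane and is at least as far as [p0] from the centre,
     [2 * l * (dot w p0 - c')] is at most the squared distance from [p] to [p0], itself at most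
     [4 * D ^+ 2]; this [l] makes it larger. *)
  pose l := (4 * D ^+ 2 + 1) / (2 * (dot w p0 - c')).
  have [p Kp pmax] := far (p0 - l *: w) (ex_intro _ p1 Kp1').
  have wp := wE _ _ Kp pmax.
  have := pmax _ Kp0; rewrite -ler_sqr ?nnegrE ?enorm_ge0 // !sqr_enorm.
  have -> : p - (p0 - l *: w) = (p - p0) + l *: w by rewrite opprB addrA addrAC.
  have -> : p0 - (p0 - l *: w) = l *: w by rewrite opprB addrC subrK.
  rewrite [X in _ <= X]dotDl !(dotDr (p - p0)).
  have -> : dot (p - p0) (l *: w) = l * (c' - dot w p0).
    by rewrite dotZr dotC dotDr dotNr wp.
  have -> : dot (l *: w) (p - p0) = l * (c' - dot w p0).
    by rewrite dotZl dotDr dotNr wp.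
  have lE : l * (c' - dot w p0) = - (4 * D ^+ 2 + 1) / 2.
    by rewrite /l; field; rewrite gt_eqF.
  have : dot (p - p0) (p - p0) <= 4 * D ^+ 2.
    rewrite -sqr_enorm -[4 * _]/(4%:R * D ^+ 2) (_ : 4%:R = 2 ^+ 2) -?exprMn;
      last by ring.
    rewrite lerXn2r ?nnegrE ?enorm_ge0 ?mulr_ge0 ?(ltW D0) //.
    apply: le_trans (enormD _ _) _; rewrite enormN.
    by have := HD _ Kp; have := HD _ Kp0; lra.
  by rewrite lE; lra.
have [p Kp pmax] := far 0 (ex_intro _ p1 Kp1').
have := fixE _ _ Kp pmax; rewrite /move g1 mul1mx => /eqP.
rewrite -subr_eq0 addrAC subrr add0r => /eqP g2.
by case: g g1 g2 {Gg gK gd fixE} => r t /= -> ->.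
Qed.

End Polyhedra.

(** * Tiles and tilings *)

Section Tiles.
Context {R : realType} {m : nat}.
Variables (A : set (set 'cV[R]_m)) (faces : set 'cV[R]_m -> set (set 'cV[R]_m)).
Hypothesis hA : alphabet A faces.
Implicit Types (p q u v : 'cV[R]_m) (g h : motion R m) (a b c K L : set 'cV[R]_m).
Implicit Types (x y P : set (set 'cV[R]_m)).

Lemma alphabet_finite : finite_set A. Proof. by case: hA. Qed.

Lemma alphabet_polyhedron a : A a -> polyhedron a.
Proof. by case: hA => _ _ + _ _ => /[apply] -[]. Qed.

Lemma alphabet_tile a : A a -> is_tile A a.
Proof. by move=> Aa; exists a; split=> //; exists (1%:M, 0); rewrite ?Tt_id //;
  exact: GE1. Qed.

Lemma tileP a : is_tile A a <-> exists j g, [/\ A j, GE g & a = Tt g j].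
Proof.
split=> [[j [Aj [g Gg ->]]]|[j [g [Aj Gg ->]]]]; first by exists j, g.
by exists j; split=> //; exists g.
Qed.

Lemma tile_Tt a g : is_tile A a -> GE g -> is_tile A (Tt g a).
Proof.
move=> /tileP [j [h [Aj Gh ->]]] Gg; apply/tileP.
by exists j, (gmul g h); rewrite Tt_mul; split=> //; exact: GE_mul.
Qed.

Lemma has_type_Tt j a g : has_type A j a -> GE g -> has_type A j (Tt g a).
Proof.
move=> [Aj [h Gh ->]] Gg; split=> //; exists (gmul g h); rewrite ?Tt_mul //.
exact: GE_mul.
Qed.

Lemma has_type_is_tile j a : has_type A j a -> is_tile A a.
Proof. by move=> ja; exists j. Qed.

Lemma tile_regular a : is_tile A a -> a = closure a°.
Proof.
move=> /tileP [j [g [Aj Gg ->]]].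
have [_ E _ _] := alphabet_polyhedron Aj.
by rewrite Tt_interior // Tt_closure // -E.
Qed.

Lemma tile_interior a : is_tile A a -> a° !=set0.
Proof.
move=> /tileP [j [g [Aj Gg ->]]].
have [_ _ [p jp] _] := alphabet_polyhedron Aj.
by exists (move g p); rewrite Tt_interior //; exists p.
Qed.

Lemma tile_connected a : is_tile A a -> connected a°.
Proof.
move=> /tileP [j [g [Aj Gg ->]]].
have [_ _ _ cj] := alphabet_polyhedron Aj.
by rewrite Tt_interior //; apply: Tt_connected.
Qed.


Lemma tile_closure a : is_tile A a -> closure a = a.
Proof.
move=> /tile_regular ->; apply/esym/closure_id; exact: closed_closure.
Qed.

Lemma tile_diam : exists2 D : R, 0 < D &
  forall a p q, is_tile A a -> a p -> a q -> enorm (p - q) <= D.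
Proof.
have [||e e0 He] := @finite_uniform R _ A
    (fun a e => forall p q, a p -> a q -> enorm (p - q) <= e^-1) alphabet_finite.
- move=> a e e' /andP[e'0 ee] H p q ap aq; apply: le_trans (H p q ap aq) _.
  by rewrite lef_pV2 ?posrE // (lt_le_trans e'0).
- move=> a /alphabet_polyhedron [/polyhedral_bounded [D D0 HD] _ _ _].
  exists (D + D)^-1; first by rewrite invr_gt0 addr_gt0.
  move=> p q ap aq; rewrite invrK; apply: le_trans (enormD _ _) _.
  by rewrite enormN lerD // HD.
exists e^-1; first by rewrite invr_gt0.
move=> a p q /tileP [j [g [Aj Gg ->]]] [p' jp' <-] [q' jq' <-].
by rewrite move_iso //; exact: (He j Aj).
Qed.

Lemma tile_inball : exists2 d : R, 0 < d &
  forall a, is_tile A a -> exists z, forall p, enorm (p - z) < d -> a p.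
Proof.
have [||d d0 Hd] := @finite_uniform R _ A
    (fun a d => exists z, forall p, enorm (p - z) < d -> a p) alphabet_finite.
- move=> a e e' /andP[_ ee] [z H]; exists z => p pz; apply: H.
  exact: lt_le_trans ee.
- move=> a /alphabet_polyhedron [_ _ [z /interior_enormP [e e0 He]] _].
  by exists e => //; exists z.
exists d => // a /tileP [j [g [Aj Gg ->]]]; have [z Hz] := Hd j Aj.
exists (move g z) => p pz; apply/TtE => //; apply: Hz.
by rewrite -(move_iso _ _ Gg) moveVK.
Qed.

Lemma tile_rigid : exists2 d : R, 0 < d & forall a g, is_tile A a -> GE g ->
  Tt g a = a -> (forall p, a p -> enorm (move g p - p) < d) -> g = (1%:M, 0).
Proof.
have [||d d0 Hd] := @finite_uniform R _ A (fun a d => forall g, GE g ->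
    Tt g a = a -> (forall p, a p -> enorm (move g p - p) < d) -> g = (1%:M, 0))
    alphabet_finite.
- move=> a e e' /andP[_ ee] H g Gg ga Hg; apply: H => // p /Hg.
  by move/lt_le_trans; apply.
- move=> a /alphabet_polyhedron [pa _ ia _]; exact: polyhedral_rigid.
exists d => // a g /tileP [j [h [Aj Gh ->]]] Gg gE Hg.
have Gi := GE_inv Gh.
pose k := gmul (ginv h) (gmul g h).
have : k = (1%:M, 0).
  apply: (Hd j Aj); first by apply: GE_mul => //; exact: GE_mul.
    by rewrite -Tt_mul -Tt_mul gE TtK.
  move=> p jp; rewrite !move_mul -(move_iso _ _ Gh) moveVK //; apply: Hg.
  by exists p.
move=> kE; have : gmul (gmul h k) (ginv h) = g.
  by rewrite /k !gmulA gmulKV // gmul1 -gmulA gmulKV // gmulg1.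
by rewrite kE gmulg1 gmulKV.
Qed.

(** A face has a nonempty relative interior, which by definition comes with a hyperplane containing
    the face. Motions carry hyperplanes to hyperplanes, so the count for the prototiles is valid for
    all tiles. *)
Lemma tile_hyperplanes : exists k : nat, forall a, is_tile A a ->
  exists s : seq ('cV[R]_m * R), [/\ (size s <= k)%N,
    (forall uc, uc \in s -> uc.1 != 0) &
    forall p, bnd a p -> exists2 uc, uc \in s & dot uc.1 p = uc.2].
Proof.
have [||d d0 Hd] := @finite_uniform R _ A (fun a d =>
  exists s : seq ('cV[R]_m * R), [/\ (size s)%:R <= d^-1,
    (forall uc, uc \in s -> uc.1 != 0) &
    forall p, bnd a p -> exists2 uc, uc \in s & dot uc.1 p = uc.2]) alphabet_finite.
- move=> a e e' /andP[e'0 ee] [s [s1 s2 s3]]; exists s; split=> //.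
  by apply: (le_trans s1); rewrite lef_pV2 ?posrE // (lt_le_trans e'0).
- move=> a Aa; have [_ _ /(_ a Aa) [_ [/finite_seqP [l lE] ff bE _]] _ _] := hA.
  have [s [sl s0 sH]] : exists s : seq ('cV[R]_m * R), [/\ size s = size l,
      (forall uc, uc \in s -> uc.1 != 0) &
      forall F p, F \in l -> F p -> exists2 uc, uc \in s & dot uc.1 p = uc.2].
    have : forall F, F \in l -> face F by move=> F Fl; apply: ff; rewrite lE.
    elim: (l) => [|F l' IH] Hl; first by exists [::].
    have [|s [sl s0 sH]] := IH; first by move=> G Gl; apply: Hl; rewrite inE Gl orbT.
    have [_ _ [q [u [c [u0 Fuc _ _]]]] _] := Hl F (mem_head _ _).
    exists ((u, c) :: s); split=> /=; first by rewrite sl.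
      by move=> uc; rewrite inE => /orP[/eqP ->|/s0].
    move=> G p; rewrite inE => /orP[/eqP -> Fp|Gl Gp].
      by exists (u, c); rewrite ?mem_head //; exact: Fuc.
    by have [uc ucs ucp] := sH _ _ Gl Gp; exists uc; rewrite // inE ucs orbT.
  exists ((size s)%:R + 1)^-1; first by rewrite invr_gt0 ltr_wpDl.
  exists s; split=> //; first by rewrite invrK lerDl.
  by move=> p; rewrite bE lE => -[F Fl Fp]; exact: sH Fl Fp.
have [k dk] : exists k : nat, d^-1 <= k%:R.
  by exists (Num.truncn d^-1).+1; apply/ltW; exact: truncnS_gt.
exists k => a /tileP [j [g [Aj Gg ->]]].
have [s [s1 s2 s3]] := Hd j Aj.
exists [seq (g.1 *m uc.1, uc.2 + dot (g.1 *m uc.1) g.2) | uc <- s]; split.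
- by rewrite size_map -(ler_nat R); exact: le_trans dk.
- move=> _ /mapP [uc /s2 u0 ->] /=; apply: contra_neq u0 => E.
  by rewrite -[uc.1]mul1mx -(SO_mulVmx Gg) -mulmxA E mulmx0.
- rewrite Tt_bnd // => _ [p /s3 [uc ucs E] <-].
  eexists; first by apply/mapP; exists uc.
  by rewrite /= /move dotDr dot_mulmx mulmxA SO_mulVmx // mul1mx E.
Qed.

Lemma tile_meets_interior a b p : is_tile A b -> a° p -> b p -> (a° `&` b°) !=set0.
Proof.
move=> /tile_regular bE ap; rewrite {1}bE => bp.
have [q [bq aq]] : (b° `&` a°) !=set0 by apply: bp; exact: nbhs_interior.
by exists q.
Qed.

Lemma tiling_tile x a : tiling A x -> x a -> is_tile A a.
Proof. by move=> [+ _ _]; apply. Qed.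

Lemma tiling_cover x p : tiling A x -> exists2 a, x a & a p.
Proof. by move=> [_ + _] => xT; have : setT p by []; rewrite -xT. Qed.

Lemma tiling_eq x a b p : tiling A x -> x a -> x b -> a° p -> b p -> a = b.
Proof.
move=> xt xa xb ap bp; have [_ _ xd] := xt.
by apply: xd => //; exact: tile_meets_interior (tiling_tile xt xb) ap bp.
Qed.

Lemma tiling_bnd_interior x a p : tiling A x -> x a -> a° p -> ~ tiling_bnd x p.
Proof.
move=> xt xa ap [b xb [bp nbp]].
rewrite (tile_closure (tiling_tile xt xb)) in bp.
by apply: nbp; rewrite -(tiling_eq xt xa xb ap bp).
Qed.

Lemma bnd_tile a p : is_tile A a -> bnd a p -> a p.
Proof. by move=> ta [+ _]; rewrite tile_closure. Qed.

Lemma tiling_TP x g : tiling A x -> GE g -> tiling A (TP g x).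
Proof.
move=> [x1 x2 x3] Gg; have Gi := GE_inv Gg; split.
- by move=> _ [a xa <-]; apply: tile_Tt => //; exact: x1.
- apply/seteqP; split=> // p _; have : setT (move (ginv g) p) by [].
  rewrite -x2 => -[a xa ap]; exists (Tt g a); first by exists a.
  exact/TtE.
- move=> _ _ [a xa <-] [b xb <-];
  rewrite !Tt_interior // => -[p [/TtE -/(_ Gg) pa /TtE -/(_ Gg) pb]].
  by congr Tt; apply: x3 => //; exists (move (ginv g) p).
Qed.

Lemma patch_TP P g : is_patch A P -> GE g -> is_patch A (TP g P).
Proof.
move=> [x xt Px] Gg; exists (TP g x); first exact: tiling_TP.
by apply: image_subset.
Qed.

Lemma patch_sub P P' : is_patch A P -> P' `<=` P -> is_patch A P'.
Proof. by move=> [x xt Px] P'P; exists x => //; exact: subset_trans Px. Qed.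

Lemma tiling_patch x : tiling A x -> is_patch A x.
Proof. by move=> xt; exists x. Qed.

Lemma patch_tiling P : is_patch A P -> \bigcup_(a in P) a = setT -> tiling A P.
Proof.
move=> [x [x1 x2 x3] Px] PT; split=> //; first by move=> a /Px /x1.
by move=> a b Pa Pb; apply: x3; exact: Px.
Qed.

(* An inscribed ball of fixed radius contains a point of a fine enough grid. *)
Lemma tile_net (l : R) : exists s : seq 'cV[R]_m, forall a p, is_tile A a -> a p ->
  enorm p <= l -> exists2 q, q \in s & a° q.
Proof.
have [D D0 HD] := tile_diam.
have [d d0 Hd] := tile_inball.
pose n := (Num.truncn ((l + D) * m.+1%:R / d)).+1.
pose f (w : {ffun 'I_m -> 'I_(n + n).+1}) : 'cV[R]_m :=
  \col_i (((w i)%:R - n%:R) * (d / m.+1%:R)).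
exists [seq f w | w : {ffun 'I_m -> 'I_(n + n).+1}] => a p ta ap pl.
have [z Hz] := Hd a ta.
have az : a z by apply: Hz; rewrite subrr enorm0.
have e0 : 0 < d / m.+1%:R by rewrite divr_gt0 ?ltr0n.
have zl i : `|z i 0| <= l + D.
  apply: le_trans (coord_le_enorm _ _) _; rewrite -(subrK p z).
  by apply: le_trans (enormD _ _) _; rewrite addrC lerD //; exact: HD ta az ap.
(* The coordinate of [z] in units of the mesh, shifted by [n] so that truncation applies to a
   nonnegative number. *)
pose c i := z i 0 / (d / m.+1%:R) + n%:R.
have ci i : 0 <= c i < (n + n)%:R.
  have : `|z i 0 / (d / m.+1%:R)| < n%:R.
    rewrite normrM [X in _ * X]ger0_norm ?invr_ge0 ?(ltW e0) // ltr_pdivrMr //.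
    apply: (le_lt_trans (zl i)); rewrite -ltr_pdivrMr // invf_div mulrA.
    exact: truncnS_gt.
  rewrite ltr_norml natrD /c => /andP[]; lra.
have cn i : (Num.truncn (c i) < (n + n).+1)%N.
  have /andP[c0 c1] := ci i; rewrite ltnS -(ler_nat R).
  by apply: le_trans (ltW c1); rewrite truncn_le.
pose w := [ffun i => Ordinal (cn i)].
exists (f w); first exact: codom_f.
apply/interior_enormP; exists (d - enorm (f w - z)); last first.
  move=> q; rewrite ltrBrDr => qf; apply: Hz.
  by apply: le_lt_trans (enorm_tri _ (f w) _) _.
rewrite subr_gt0; apply: le_lt_trans (enorm_le_sum _) _.
apply: (@le_lt_trans _ _ (\sum_(i < m) (d / m.+1%:R))).
  apply: ler_sum => i _; rewrite !mxE ffunE /=.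
  have /andP[c0 c1] := ci i; have /andP[t0 t1] := truncn_itv c0.
  have -> : z i 0 = (c i - n%:R) * (d / m.+1%:R).
    by rewrite /c addrK mulfVK // gt_eqF.
  rewrite -mulrBl normrM [X in _ * X]ger0_norm ?(ltW e0) // ger_pMl // ler_norml.
  by move: t1; rewrite -natr1; lra.
rewrite sumr_const card_ord -[_ *+ m]mulr_natr mulrAC -mulrA -[ltRHS]mulr1.
by rewrite ltr_pM2l // ltr_pdivrMr ?ltr0n // mul1r ltr_nat.
Qed.

(** Each point of the net is interior to at most one tile of [x]. *)
Lemma tiling_locally_finite x (l : R) : tiling A x ->
  finite_set [set a | x a /\ exists2 p, a p & enorm p <= l].
Proof.
move=> xt; have [s Hs] := tile_net l.
pose F q := [set a | x a /\ a° q].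
apply: (@sub_finite_set _ _ (\bigcup_(q in [set` s]) F q)).
  move=> a [xa [p ap pl]]; have [q qs aq] := Hs a p (tiling_tile xt xa) ap pl.
  by exists q.
apply: bigcup_finite; first exact: finite_seq.
move=> q _; have [->|/set0P [a [xa aq]]] := eqVneq (F q) set0.
  exact: finite_set0.
apply: (@sub_finite_set _ _ [set a]); last exact: finite_set1.
move=> b [xb bq]; apply/esym; apply: (tiling_eq xt xa xb aq).
exact: interior_subset.
Qed.

End Tiles.

(** * Ultralimits of motions *)

Lemma free_ultrafilter : exists2 U : set_system nat, UltraFilter U &
  forall n, U [set i | (n <= i)%N].
Proof.
have [U [UU sub]] := @ultraFilterLemma nat \oo _.
by exists U => // n; apply: sub; exists n.
Qed.

Section Ultralimits.
Variable U : set_system nat.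
Hypothesis UU : UltraFilter U.

#[local] Instance ultra_filter_proper : ProperFilter U := ultra_proper.

Lemma ultra_finite (T : choiceType) (A : set T) (f : nat -> T) : finite_set A ->
  (\forall i \near U, A (f i)) -> exists2 a, A a & \forall i \near U, f i = a.
Proof.
move=> /finite_seqP [s ->]; elim: s => [|a s IH] H.
  by have [i] := @filter_ex _ U _ _ H; rewrite /= in_nil.
have [Ha|Ha] := @in_ultra_setVsetC _ U [set i | f i = a] UU.
  by exists a => //=; rewrite mem_head.
have [|b bs Hb] := IH.
  near=> i; have : i \in [set i | f i = a]%classic = false.
    by apply/negP; rewrite inE; near: i; exact: Ha.
  have : [set` a :: s] (f i) by near: i; exact: H.
  rewrite /= inE => /orP[/eqP fia|//]; by rewrite mem_set.
by exists b => //=; rewrite inE bs orbT.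
Unshelve. all: by end_near. Qed.

Context {R : realType}.

Lemma ultra_bounded (f : nat -> R) (M : R) : (\forall i \near U, `|f i| <= M) ->
  exists l : R, f @ U --> l.
Proof.
move=> fM; have := @segment_compact R (- M) M.
rewrite compact_ultra => /(_ (f @ U)) [].
- split.
    exact: fmap_proper_filter.
  move=> G PG sub; apply/seteqP; split; last exact: sub.
  move=> B GB; have [//|nB] := @in_ultra_setVsetC _ U (f @^-1` B) UU.
  have : G (~` B) by apply: sub.
  move=> GnB; have [z [Bz nBz]] : (B `&` ~` B) !=set0 by apply:
    (@filter_ex _ G); exact: filterI.
  by [].
- by apply: filterS fM => i; rewrite /= in_itv /= ler_norml.
- by move=> l [_ fl]; exists l.
Qed.

Lemma ulim_sum (I : Type) (s : seq I) (F : I -> nat -> R) (L : I -> R) :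
  (forall c, F c @ U --> L c) ->
  (fun i => \sum_(c <- s) F c i) @ U --> \sum_(c <- s) L c.
Proof.
move=> H; elim: s => [|c s IH].
  by rewrite big_nil; under eq_cvg do rewrite big_nil; exact: cvg_cst.
by rewrite big_cons; under eq_cvg do rewrite big_cons; exact: cvgD.
Qed.

Lemma ulim_prod (I : Type) (s : seq I) (F : I -> nat -> R) (L : I -> R) :
  (forall c, F c @ U --> L c) ->
  (fun i => \prod_(c <- s) F c i) @ U --> \prod_(c <- s) L c.
Proof.
move=> H; elim: s => [|c s IH].
  by rewrite big_nil; under eq_cvg do rewrite big_nil; exact: cvg_cst.
by rewrite big_cons; under eq_cvg do rewrite big_cons; exact: cvgM.
Qed.

Context {m : nat}.
Implicit Types (p q : 'cV[R]_m) (g h : motion R m) (K : set 'cV[R]_m).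

Lemma ulim_SO (r_ : nat -> 'M[R]_m) (r : 'M[R]_m) : (forall i, SO (r_ i)) ->
  (forall a b, (fun i => r_ i a b) @ U --> r a b) -> SO r.
Proof.
move=> Sr H; split.
- apply/matrixP => a b.
  have : (fun i => (r_ i *m (r_ i)^T) a b) @ U --> (r *m r^T) a b.
    under eq_cvg do rewrite mxE; rewrite mxE; apply: ulim_sum => c.
    by under eq_cvg do rewrite mxE; rewrite mxE; exact: cvgM.
  under eq_cvg do rewrite SO_mulmxV //.
  move=> H1; apply: (@cvg_unique _ _ _ _ _ _ H1) => //; exact: cvg_cst.
- have : (fun i => \det (r_ i)) @ U --> \det r.
    rewrite /determinant; apply: ulim_sum => s; apply: cvgM; first exact: cvg_cst.
    exact: ulim_prod.
  have -> : (fun i => \det (r_ i)) = (fun=> 1) by apply/funext => i; case: (Sr i).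
  move=> H1; apply: (@cvg_unique _ _ _ _ _ _ H1) => //; exact: cvg_cst.
Qed.

(** Uniform convergence on balls; by linearity, convergence of the entries suffices. *)
Definition glim (g_ : nat -> motion R m) g := forall l e : R, 0 < e ->
  \forall i \near U, forall p, enorm p <= l -> enorm (move (g_ i) p - move g p) < e.

Lemma motion_compact (g_ : nat -> motion R m) (M : R) : (forall i, GE (g_ i)) ->
  (\forall i \near U, enorm (g_ i).2 <= M) -> exists2 g, GE g & glim g_ g.
Proof.
move=> Gg gM.
have Hr a b : exists l : R, (fun i => (g_ i).1 a b) @ U --> l.
  apply: (@ultra_bounded _ 1); apply: filterE => i; have := Gg i.
  rewrite /GE /= => Sg.
  (* An entry of a rotation is a coordinate of the image of a unit vector, hence at most 1 in
     absolute value. *)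
  have -> : (g_ i).1 a b = ((g_ i).1 *m delta_mx b 0 : 'cV_m) a 0.
    rewrite mxE (bigD1 b) //= mxE !eqxx mulr1 big1 ?addr0 // => c /negPf cb.
    by rewrite mxE cb mulr0.
  apply: (le_trans (coord_le_enorm _ _)); rewrite enorm_SO // enormE.
  rewrite /dot (bigD1 b) //= mxE !eqxx mulr1 big1 ?addr0 ?sqrtr1 // => c /negPf cb.
  by rewrite mxE cb mulr0.
have Ht a : exists l : R, (fun i => (g_ i).2 a 0) @ U --> l.
  apply: (@ultra_bounded _ M); apply: filterS gM => i.
  exact: le_trans (coord_le_enorm _ _).
have [r rE] := choice (fun ab => Hr ab.1 ab.2); have [t tE] := choice Ht.
pose g : motion R m := (\matrix_(a, b) r (a, b), \col_a t a).
have g1 a b : (fun i => (g_ i).1 a b) @ U --> g.1 a b.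
  by rewrite mxE; exact: (rE (a, b)).
have g2 a : (fun i => (g_ i).2 a 0) @ U --> g.2 a 0 by rewrite mxE; exact: tE.
exists g; first by apply: (@ulim_SO (fun i => (g_ i).1)) => //; exact: Gg.
move=> l e e0.
pose F i := \sum_a (\sum_b `|(g_ i).1 a b - g.1 a b| * `|l| + `|(g_ i).2 a 0 -
  g.2 a 0|).
have F0 : F @ U --> (0 : R).
  have -> : (0 : R) = \sum_(a < m) (\sum_(b < m) (0 * `|l|) + 0).
    by rewrite big1 // => a _; rewrite big1 ?addr0 // => b _; rewrite mul0r.
  apply: ulim_sum => a; apply: cvgD; first apply: ulim_sum => b.
    apply: cvgM; last exact: cvg_cst.
    have -> : (0 : R) = `|g.1 a b - g.1 a b| by rewrite subrr normr0.
    apply: cvg_norm.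
    by apply: cvgB => //; exact: cvg_cst.
  have -> : (0 : R) = `|g.2 a 0 - g.2 a 0| by rewrite subrr normr0.
  apply: cvg_norm.
  by apply: cvgB => //; exact: cvg_cst.
have Flt : \forall i \near U, F i < e by apply: (cvgr_lt 0).
apply: filterS Flt => i Fe p pl.
apply: le_lt_trans Fe; apply: le_trans (enorm_le_sum _) _.
apply: ler_sum => a _; rewrite /move.
have -> : ((g_ i).1 *m p + (g_ i).2 - (g.1 *m p + g.2)) a 0 =
  \sum_b ((g_ i).1 a b - g.1 a b) * p b 0 + ((g_ i).2 a 0 - g.2 a 0).
  rewrite opprD addrACA -mulmxBl mxE; congr (_ + _);
    last by rewrite [LHS]mxE [in LHS](mxE _ _ a 0).
  by rewrite mxE; apply: eq_bigr => b _; rewrite mxE [in LHS](mxE _ _ a b).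
apply: le_trans (ler_normD _ _) _; rewrite lerD2r.
apply: le_trans (ler_norm_sum _ _ _) _; apply: ler_sum => b _.
rewrite normrM ler_wpM2l //; apply: le_trans (coord_le_enorm _ _) _.
exact: le_trans pl (ler_norm l).
Qed.

Lemma glim_cst g : glim (fun=> g) g.
Proof.
by move=> l e e0; apply: filterE => i p _; rewrite subrr enorm0.
Qed.

End Ultralimits.

(** * Rigidity of nearby tilings *)

Section TilingMetric.
Context {R : realType} {m : nat}.
Implicit Types (p q : 'cV[R]_m) (x y : set (set 'cV[R]_m)).

Lemma hausdorff_distC (K L : set 'cV[R]_m) : hausdorff_dist K L = hausdorff_dist L K.
Proof. by rewrite /hausdorff_dist; congr maxe; rewrite maxC. Qed.

Lemma tdistC x y : tdist x y = tdist y x.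
Proof.
by rewrite /tdist; congr ereal_sup; apply/seteqP; split=> _ [n n0 <-];
  exists n; rewrite // hausdorff_distC.
Qed.

Lemma tdist_close x y (e : R) n p : (tdist x y < e%:E)%E -> (0 < n)%N ->
  enorm p <= n%:R -> tiling_bnd x p ->
  exists2 q, tiling_bnd y q & enorm (p - q) < n%:R * e.
Proof.
move=> xye n0 pn xp; have nR : 0 < n%:R :> R by rewrite ltr0n.
have H : (hausdorff_dist (eball n%:R `&` tiling_bnd x) (eball n%:R `&` tiling_bnd y)
    < (n%:R * e)%:E)%E.
  rewrite EFinM -lte_pdivrMl //; apply: le_lt_trans xye.
  by apply: ereal_sup_ubound; exists n.
move: H; rewrite /hausdorff_dist !gt_max => /and3P[_ H _].
have : (ereal_inf [set (enorm (p - q))%:E | q in eball n%:R `&` tiling_bnd y]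
    < (n%:R * e)%:E)%E.
  by apply: le_lt_trans H; apply: ereal_sup_ubound; exists p.
by move=> /ereal_inf_lt [_ [q [_ yq] <-]]; rewrite lte_fin; exists q.
Qed.

Lemma hausdorff_dist_le (K L : set 'cV[R]_m) (d : R) : 0 <= d ->
  (forall p, K p -> exists2 q, L q & enorm (p - q) <= d) ->
  (forall q, L q -> exists2 p, K p & enorm (q - p) <= d) ->
  (hausdorff_dist K L <= d%:E)%E.
Proof.
move=> d0 KL LK; rewrite /hausdorff_dist !ge_max lee_fin d0 /=.
have aux (M N : set 'cV[R]_m) : (forall p, M p -> exists2 q,
  N q & enorm (p - q) <= d) ->
  (ereal_sup [set ereal_inf [set (enorm (p - q))%:E | q in N] | p in M] <= d%:E)%E.
  move=> MN; apply: ge_ereal_sup => _ [p /MN [q Nq pq] <-].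
  apply: (@le_trans _ _ (enorm (p - q))%:E); last by rewrite lee_fin.
  by apply: ereal_inf_lbound; exists q.
by rewrite !aux.
Qed.

Lemma tdist_le x y (d : R) : 0 <= d ->
  (forall n p, (0 < n)%N -> enorm p <= n%:R -> tiling_bnd x p ->
     exists q, [/\ enorm q <= n%:R, tiling_bnd y q & enorm (p - q) <= n%:R * d]) ->
  (forall n p, (0 < n)%N -> enorm p <= n%:R -> tiling_bnd y p ->
     exists q, [/\ enorm q <= n%:R, tiling_bnd x q & enorm (p - q) <= n%:R * d]) ->
  (tdist x y <= d%:E)%E.
Proof.
move=> d0 H1 H2; apply: ge_ereal_sup => _ [n n0 <-].
rewrite lee_pdivrMl ?ltr0n //; apply: hausdorff_dist_le.
- by rewrite mulr_ge0.
- by move=> p [pn xp]; have [q [? ? ?]] := H1 n p n0 pn xp; exists q.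
- by move=> p [pn xp]; have [q [? ? ?]] := H2 n p n0 pn xp; exists q.
Qed.

End TilingMetric.

Section Rigidity.
Context {R : realType} {m : nat}.
Variables (A : set (set 'cV[R]_m)) (faces : set 'cV[R]_m -> set (set 'cV[R]_m)).
Hypothesis hA : alphabet A faces.
Implicit Types (p q : 'cV[R]_m) (g h : motion R m) (a b c : set 'cV[R]_m).
Implicit Types (x y : set (set 'cV[R]_m)).

Section Limits.
Variable U : set_system nat.
Hypothesis UU : UltraFilter U.
#[local] Existing Instance ultra_filter_proper.

(** For suitable [i], [q] is close to a boundary point of [y_ i], hence to one of [x_ i], while a
    whole ball about [q] is inside a single tile of [x_ i]. *)
Lemma ulim_bnd_interior (x_ y_ : nat -> set (set 'cV[R]_m))
    (h_ k_ : nat -> motion R m) h k a b q :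
  (forall i, tiling A (x_ i)) ->
  (forall e : R, 0 < e -> \forall i \near U, (tdist (y_ i) (x_ i) < e%:E)%E) ->
  (forall i, GE (h_ i)) -> GE h -> (forall i, GE (k_ i)) -> GE k ->
  glim U h_ h -> glim U k_ k ->
  (\forall i \near U, x_ i (Tt (h_ i) a)) -> (\forall i \near U,
    y_ i (Tt (k_ i) b)) ->
  (Tt h a)° q -> bnd (Tt k b) q -> False.
Proof.
move=> xt xy Gh_ Gh Gk_ Gk hl kl xa yb /interior_enormP [e e0 He].
rewrite Tt_bnd // => -[w bw wq].
(* Four displacements below [d] are added: from [q] to [q1], to [q2], to [z], to [move h v]. The
   bound 1 keeps [q1] in the ball of radius [n]. *)
pose d := Num.min 1 e / 4.
have d0 : 0 < d by rewrite divr_gt0 // lt_min ltr01 e0.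
have d1 : 4 * d <= 1 by rewrite mulrC divfK // ge_min lexx.
have de : 4 * d <= e by rewrite mulrC divfK // ge_min lexx orbT.
pose n := (Num.truncn (enorm q + 1)).+1.
have nq : enorm q + 1 < n%:R by exact: truncnS_gt.
have n0 : 0 < n%:R :> R by rewrite ltr0n.
pose l := enorm q + enorm (move h 0) + 4.
near U => i.
have Gi := GE_inv (Gh_ i).
have xia : x_ i (Tt (h_ i) a) by near: i.
have yib : y_ i (Tt (k_ i) b) by near: i.
have Hh p : enorm p <= l -> enorm (move (h_ i) p - move h p) < d.
  by move: p; near: i; exact: hl.
have Hk p : enorm p <= enorm w -> enorm (move (k_ i) p - move k p) < d.
  by move: p; near: i; exact: kl.
have xyi : (tdist (y_ i) (x_ i) < (d / n%:R)%:E)%E.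
  by near: i; apply: xy; rewrite divr_gt0.
pose q1 := move (k_ i) w.
have qq1 : enorm (q1 - q) < d by rewrite -wq; exact: Hk.
have q1b : tiling_bnd (y_ i) q1.
  by exists (Tt (k_ i) b) => //; rewrite Tt_bnd //; exists w.
have [|q2 q2b] := tdist_close xyi (isT : (0 < n)%N) _ q1b.
  have := enormD (q1 - q) q; rewrite subrK; lra.
rewrite mulrC divfK ?gt_eqF // => q12.
apply: (tiling_bnd_interior hA (xt i) xia _ q2b).
apply/interior_enormP; exists d => // z zq2.
pose v := move (ginv (h_ i)) z.
have zE : z = move (h_ i) v by rewrite moveVK.
have H1 : enorm (z - q) < 3 * d.
  have := enorm_tri z q2 q; have := enorm_tri q2 q1 q.
  by rewrite (enormB q2 q1); lra.
have vl : enorm v <= l.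
  have h0 : enorm (move (h_ i) 0 - move h 0) < d.
    by apply: Hh; rewrite enorm0 /l !addr_ge0 ?enorm_ge0.
  have : enorm v = enorm (z - move (h_ i) 0) by rewrite zE move_iso // subr0.
  have := enorm_tri z q (move (h_ i) 0); have := enorm_tri q 0 (move (h_ i) 0).
  have := enorm_tri 0 (move h 0) (move (h_ i) 0).
  rewrite subr0 !sub0r !enormN (enormB (move h 0)) /l; lra.
apply/TtE => //; rewrite -/v.
have /TtE : Tt h a (move h v).
  apply: He; have := enorm_tri (move h v) z q.
  by rewrite (enormB (move h v) z); have := Hh v vl; rewrite -zE; lra.
by rewrite moveK //; apply.
Unshelve. all: by end_near. Qed.

(** The interior of the first limit tile is connected, meets the second one and avoids its boundary,
    so it stays inside. *)
Lemma ulim_subset (x_ y_ : nat -> set (set 'cV[R]_m))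
    (h_ k_ : nat -> motion R m) h k a b :
  (forall i, tiling A (x_ i)) ->
  (forall e : R, 0 < e -> \forall i \near U, (tdist (y_ i) (x_ i) < e%:E)%E) ->
  (forall i, GE (h_ i)) -> GE h -> (forall i, GE (k_ i)) -> GE k ->
  glim U h_ h -> glim U k_ k ->
  (\forall i \near U, x_ i (Tt (h_ i) a)) -> (\forall i \near U,
    y_ i (Tt (k_ i) b)) ->
  is_tile A a -> is_tile A b -> ((Tt h a)° `&` (Tt k b)°) !=set0 ->
  Tt h a `<=` Tt k b.
Proof.
move=> xt xy Gh_ Gh Gk_ Gk hl kl xa yb ta tb [p [pa pb]].
have sub : (Tt h a)° `<=` Tt k b.
  move=> q qa; apply: contrapT => nqb.
  have [||z za zb] := @connected_meets_bnd _ _ _ (Tt k b) p q _ pa _ qa nqb.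
    by apply: (tile_connected hA); apply: tile_Tt.
    exact: interior_subset.
  exact: (ulim_bnd_interior xt xy Gh_ Gh Gk_ Gk hl kl xa yb za zb).
rewrite (tile_regular hA (tile_Tt ta Gh)) -(tile_closure hA (tile_Tt tb Gk)).
exact: closure_subset.
Qed.

Lemma ulim_tile_eq (x_ y_ : nat -> set (set 'cV[R]_m))
    (h_ k_ : nat -> motion R m) h k a b :
  (forall i, tiling A (x_ i)) -> (forall i, tiling A (y_ i)) ->
  (forall e : R, 0 < e -> \forall i \near U, (tdist (y_ i) (x_ i) < e%:E)%E) ->
  (forall i, GE (h_ i)) -> GE h -> (forall i, GE (k_ i)) -> GE k ->
  glim U h_ h -> glim U k_ k ->
  (\forall i \near U, x_ i (Tt (h_ i) a)) -> (\forall i \near U,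
    y_ i (Tt (k_ i) b)) ->
  is_tile A a -> is_tile A b -> ((Tt h a)° `&` (Tt k b)°) !=set0 ->
  Tt h a = Tt k b.
Proof.
move=> xt yt xy Gh_ Gh Gk_ Gk hl kl xa yb ta tb meet.
apply/seteqP; split; first exact: (ulim_subset xt xy Gh_ Gh Gk_ Gk hl kl xa yb).
apply: (ulim_subset yt _ Gk_ Gk Gh_ Gh kl hl yb xa) => //; last by rewrite setIC.
move=> e e0; have := xy e e0; apply: filterS => i; by rewrite tdistC.
Qed.

(** The tile of [x] at an interior point of the limit tile must be the limit tile: this is
    [ulim_tile_eq] with a constant sequence. *)
Lemma ulim_tile_in x (y_ : nat -> set (set 'cV[R]_m)) (k_ : nat -> motion R m) k b :
  tiling A x -> (forall i, tiling A (y_ i)) ->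
  (forall e : R, 0 < e -> \forall i \near U, (tdist (y_ i) x < e%:E)%E) ->
  (forall i, GE (k_ i)) -> GE k -> glim U k_ k ->
  (\forall i \near U, y_ i (Tt (k_ i) b)) -> is_tile A b -> x (Tt k b).
Proof.
move=> xt yt xy Gk_ Gk kl yb tb.
have tkb := tile_Tt tb Gk.
have [p pb] := tile_interior hA tkb.
have [c xc cp] := tiling_cover p xt.
have tc := tiling_tile xt xc.
have meet := tile_meets_interior hA tc pb cp.
suff <- : Tt (1%:M, 0) c = Tt k b by rewrite Tt_id.
have xi : \forall i \near U, (fun=> x) i (Tt ((fun=> (1%:M, 0)) i) c).
  by apply: filterE => i; rewrite Tt_id.
apply: (ulim_tile_eq (fun=> xt) yt xy (fun=> GE1) GE1 Gk_ Gk (glim_cst _ _) kl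
  xi yb) => //.
by rewrite Tt_id setIC.
Qed.

(** Finiteness of the alphabet selects one prototile; the common point [p] bounds the
    translations. *)
Lemma ulim_tile (e_ : nat -> set 'cV[R]_m) p :
  (forall i, is_tile A (e_ i)) -> (forall i, e_ i p) ->
  exists a (h_ : nat -> motion R m) h, [/\ A a, forall i, GE (h_ i), GE h,
    glim U h_ h &
    \forall i \near U, e_ i = Tt (h_ i) a].
Proof.
move=> te ep; have ex i : exists z : set 'cV[R]_m * motion R m,
    [/\ A z.1, GE z.2 & e_ i = Tt z.2 z.1].
  by have /tileP [j [g [? ? ?]]] := te i; exists (j, g).
have [f Hf] := choice ex.
have [|a Aa fa] := @ultra_finite U UU _ A (fun i => (f i).1) (alphabet_finite hA).
  by apply: filterE => i; have [] := Hf i.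
have Gf i : GE (f i).2 by have [] := Hf i.
have [/polyhedral_bounded [D _ HD] _ _ _] := alphabet_polyhedron hA Aa.
have eE : \forall i \near U, e_ i = Tt (f i).2 a.
  by apply: filterS fa => i <-; have [] := Hf i.
have [|h Gh hl] := @motion_compact U UU R m (fun i => (f i).2) (enorm p + D) Gf.
  apply: filterS eE => i eiE; have := ep i; rewrite eiE => -[w aw wp].
  have -> : (f i).2.2 = move (f i).2 0 by rewrite /move mulmx0 add0r.
  rewrite -(subrK p (move _ 0)) addrC.
  apply: (le_trans (enormD _ _)); rewrite lerD2l -wp move_iso // sub0r enormN.
  exact: HD.
by exists a, (fun i => (f i).2), h.
Qed.

Lemma ulim_tile_mem (h_ : nat -> motion R m) h a p : is_tile A a -> GE h ->
  glim U h_ h -> (\forall i \near U, Tt (h_ i) a p) -> Tt h a p.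
Proof.
move=> ta Gh hl ap; have [D D0 HD] := tile_diam hA.
have [w0 /interior_subset aw0] := tile_interior hA ta.
apply/TtE => //; rewrite -[a](tile_closure hA ta).
apply/closure_enormP => e e0.
have [i [[w aw wp] Hi]] := filter_ex (filterI ap (hl (D + enorm w0) e e0)).
exists w => //; rewrite -(move_iso _ _ Gh) moveVK // -wp enormB; apply: Hi.
by have := HD a w w0 ta aw aw0; have := enormD (w - w0) w0; rewrite subrK; lra.
Qed.

End Limits.

Lemma tile_close (d : R) : 0 < d -> exists2 e : R, 0 < e &
  forall x y c, tiling A x -> tiling A y -> (tdist y x < e%:E)%E -> x c -> c 0 ->
  exists g, [/\ GE g, y (Tt g c) & forall p, c p -> enorm (move g p - p) < d].
Proof.
move=> d0; apply: contrapT => nex.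
pose good x y c := exists g, [/\ GE g, y (Tt g c) & forall p,
  c p -> enorm (move g p - p) < d].
have bad (i : nat) : exists z :
  (set (set 'cV[R]_m) * set (set 'cV[R]_m) * set 'cV[R]_m),
  [/\ tiling A z.1.1, tiling A z.1.2, (tdist z.1.2 z.1.1 < (i.+1%:R^-1)%:E)%E,
      z.1.1 z.2 /\ z.2 0 & ~ good z.1.1 z.1.2 z.2].
  apply: contrapT => nz; apply: nex; exists i.+1%:R^-1;
    first by rewrite invr_gt0 ltr0n.
  by move=> x y c xt yt xy xc c0; apply: contrapT => ng; apply: nz; exists (x, y, c).
have [z Hz] := choice bad => {bad nex}.
pose x_ i := (z i).1.1; pose y_ i := (z i).1.2; pose c_ i := (z i).2.
have xt i : tiling A (x_ i) by have [] := Hz i.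
have yt i : tiling A (y_ i) by have [] := Hz i.
have xc i : x_ i (c_ i) by have [_ _ _ []] := Hz i.
have c0 i : c_ i 0 by have [_ _ _ []] := Hz i.
have ng i : ~ good (x_ i) (y_ i) (c_ i) by have [] := Hz i.
have [U UU Un] := free_ultrafilter.
have PU := ultra_filter_proper UU.
have xy (e : R) : 0 < e -> \forall i \near U, (tdist (y_ i) (x_ i) < e%:E)%E.
  move=> e0; have : U [set i | ((Num.truncn e^-1).+1 <= i)%N] by exact: Un.
  apply: filterS => i /= ie; have [_ _ H _ _] := Hz i.
  apply: (lt_le_trans H); rewrite lee_fin -[leRHS]invrK lef_pV2 ?posrE ?ltr0n
    ?invr_gt0 //.
  apply/ltW/(lt_le_trans (truncnS_gt _)); rewrite ler_nat;
    exact: leq_trans (leqnSn i).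
have [a [h_ [h [Aa Gh_ Gh hl cE]]]] := ulim_tile UU (fun i =>
  tiling_tile (xt i) (xc i)) c0.
(* The origin may lie on the boundary of the limit tile, where the choice of a tile of [y_ i] would
   be ambiguous; hence an interior point [p]. *)
have [p pa] := tile_interior hA (tile_Tt (alphabet_tile Aa) Gh).
have ex i : exists e, y_ i e /\ e p.
  by have [e ye ep] := tiling_cover p (yt i); exists e.
have [e_ He] := choice ex.
have [b [k_ [k [Ab Gk_ Gk kl eE]]]] :=
  ulim_tile UU (fun i => tiling_tile (yt i) (He i).1) (fun i => (He i).2).
have tb := alphabet_tile Ab; have ta := alphabet_tile Aa.
have kp : Tt k b p.
  apply: (ulim_tile_mem UU tb Gk kl).
  by apply: filterS eE => i <-; exact: (He i).2.
have hk : Tt h a = Tt k b.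
  apply: (ulim_tile_eq UU xt yt xy Gh_ Gh Gk_ Gk hl kl) => //.
  - by apply: filterS cE => i <-.
  - by apply: filterS eE => i <-; exact: (He i).1.
  - by have := tile_meets_interior hA (tile_Tt tb Gk) pa kp.
have [D D0 HD] : exists2 D : R, 0 < D & forall w, a w -> enorm w <= D.
  by have [/polyhedral_bounded] := alphabet_polyhedron hA Aa.
have d2 : 0 < d / 2 by rewrite divr_gt0.
pose l := D + enorm (move h 0) + enorm (move k 0).
have [i [[Hh Hk] [ciE eiE]]] :=
  filter_ex (filterI (filterI (hl D _ d2) (kl l _ d2)) (filterI cE eE)).
have Gki := GE_inv Gk; have Ghi := GE_inv (Gh_ i).
(* Go from [c_ i] to the limit tile, then to the tile of [y_ i]. The motions [h] and [k] reach the
   same limit tile but may differ by a symmetry of it, which the middle factor corrects. *)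
case: (ng i); exists (gmul (k_ i) (gmul (gmul (ginv k) h) (ginv (h_ i)))); split.
- by do !apply: GE_mul.
- by rewrite ciE -!Tt_mul TtK // hk TtK // -eiE; exact: (He i).1.
- rewrite ciE => _ [w aw <-]; rewrite !move_mul moveK //.
  have H1 := Hh w (HD w aw).
  have : enorm (move (ginv k) (move h w)) <= l.
    rewrite -[move (ginv k) _]subr0 -(move_iso _ _ Gk) moveVK //.
    have := enorm_tri (move h w) (move h 0) (move k 0); rewrite move_iso // subr0.
    have := HD w aw; have := enormD (move h 0) (- move k 0); rewrite enormN /l; lra.
  move/Hk; rewrite moveVK // => H2.
  have := enorm_tri (move (k_ i) (move (ginv k) (move h w))) (move h w) (move
    (h_ i) w).
  by rewrite (enormB (move h w) (move (h_ i) w)); lra.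
Qed.

End Rigidity.

(** * Substitutions and the groups O_j *)

Section Substitution.
Context {R : realType} {m : nat}.
Variables (A : set (set 'cV[R]_m)) (faces : set 'cV[R]_m -> set (set 'cV[R]_m)).
Hypothesis hA : alphabet A faces.
Variables (phi : set (set 'cV[R]_m) -> set (set 'cV[R]_m)) (lam : R).
Hypothesis hphi : substitution A faces phi lam.
Implicit Types (p q : 'cV[R]_m) (g h : motion R m) (a b c : set 'cV[R]_m).
Implicit Types (x y P Q : set (set 'cV[R]_m)).

Lemma lam_gt1 : 1 < lam. Proof. exact: (subst_factor hphi). Qed.

Lemma lam_gt0 : 0 < lam. Proof. exact: lt_trans lam_gt1. Qed.

Lemma lamX_gt0 n : 0 < lam ^+ n. Proof. by rewrite exprn_gt0 // lam_gt0. Qed.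

Lemma tile_patch a : is_tile A a -> is_patch A [set a].
Proof.
move=> /tileP [j [g [Aj Gg ->]]]; rewrite -TP_set1; apply: patch_TP => //.
exact: subst_alphabet hphi _ Aj.
Qed.

Lemma patch_tile P a : is_patch A P -> P a -> is_tile A a.
Proof. by move=> [x xt Px] /Px; exact: tiling_tile. Qed.

Lemma conj_dil_comp (l l' : R) g : conj_dil l (conj_dil l' g) = conj_dil (l * l') g.
Proof. by rewrite /conj_dil /= scalerA. Qed.

Lemma conj_dil1 g : conj_dil 1 g = g.
Proof. by case: g => r t; rewrite /conj_dil /= scale1r. Qed.

Lemma subst_mono P Q : is_patch A Q -> P `<=` Q -> phi P `<=` phi Q.
Proof.
move=> hQ PQ; have hP := patch_sub hQ PQ.
by rewrite (subst_bigcup hphi hP) (subst_bigcup hphi hQ); exact: bigcup_subset.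
Qed.

Lemma iter_patch n P : is_patch A P -> is_patch A (iter n phi P).
Proof. by move=> hP; elim: n => //= n IH; exact: subst_patch hphi _ IH. Qed.

Lemma iter_TP n g P : GE g -> is_patch A P ->
  iter n phi (TP g P) = TP (conj_dil (lam ^+ n) g) (iter n phi P).
Proof.
move=> Gg hP; elim: n => [|n IH]; first by rewrite expr0 conj_dil1.
rewrite /= IH (subst_equiv hphi) ?conj_dil_comp ?exprS //; exact: iter_patch.
Qed.

Lemma iter_Tt n g a : GE g -> is_tile A a ->
  iter n phi [set Tt g a] = TP (conj_dil (lam ^+ n) g) (iter n phi [set a]).
Proof. by move=> Gg ta; rewrite -TP_set1 iter_TP //; exact: tile_patch. Qed.

Lemma iter_mono n P Q : is_patch A Q -> P `<=` Q -> iter n phi P `<=` iter n phi Q.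
Proof.
by move=> hQ PQ; elim: n => //= n IH; apply: subst_mono => //; exact: iter_patch.
Qed.

Lemma iter_bigcup n P : is_patch A P ->
  iter n phi P = \bigcup_(a in P) iter n phi [set a].
Proof.
move=> hP; elim: n => [|n IH]; first by apply/seteqP;
  split=> [a Pa|a [b Pb ->]]; first exists a.
apply/seteqP; split; last first.
  by apply: bigcup_sub => a Pa; apply: iter_mono => // _ ->.
move=> c; rewrite /= (subst_bigcup hphi) => [[b]|]; last exact: iter_patch.
rewrite IH => -[a Pa ab] bc; exists a => //.
have ha : is_patch A [set a] by apply: tile_patch; exact: patch_tile hP Pa.
rewrite (subst_bigcup hphi); last exact: iter_patch.
by exists b.
Qed.

Lemma iter_union n P p : is_patch A P ->
  (exists2 c, iter n phi P c & c p) <-> exists2 a, P a & a ((lam ^+ n)^-1 *: p).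
Proof.
move=> hP; elim: n p => [|n IH] p; first by rewrite expr0 invr1 scale1r.
have hn := iter_patch n hP; have l0 := lam_gt0.
have -> : (lam ^+ n.+1)^-1 *: p = (lam ^+ n)^-1 *: (lam^-1 *: p).
  by rewrite scalerA exprSr invfM mulrC.
rewrite -IH /= (subst_bigcup hphi) //; split.
- move=> [c [b nb bc] cp]; exists b => //.
  have : (\bigcup_(d in phi [set b]) d) p by exists c.
  rewrite (subst_subdivide hphi); last exact: patch_tile nb.
  by move=> [q bq <-]; rewrite scalerA mulVf ?gt_eqF // scale1r.
- move=> [b nb bp]; have : (\bigcup_(d in phi [set b]) d) p.
    rewrite (subst_subdivide hphi); last exact: patch_tile nb.
    exists (lam^-1 *: p) => //; by rewrite scalerA divff ?gt_eqF // scale1r.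
  by move=> [c bc cp]; exists c => //; exists b.
Qed.

Lemma iter_tiling n x : tiling A x -> tiling A (iter n phi x).
Proof.
move=> xt; have hx := tiling_patch xt; apply: patch_tiling; first exact: iter_patch.
apply/seteqP; split=> // p _.
have [a xa ap] := tiling_cover ((lam ^+ n)^-1 *: p) xt.
have /(iter_union n p hx) [c] : exists2 a, x a & a ((lam ^+ n)^-1 *: p) by exists a.
by exists c.
Qed.

Lemma patch_eq P a b p : is_patch A P -> P a -> P b -> a° p -> b p -> a = b.
Proof. by move=> [x xt Px] /Px xa /Px xb; exact: (tiling_eq hA xt). Qed.

(** A tile is determined by its supertile, so that finitely many supertiles come from finitely many
    tiles; [Xphi_surj] relies on this. *)
Lemma tile_of_supertile n a : is_tile A a ->
  a = [set p | exists2 d, iter n phi [set a] d & d (lam ^+ n *: p)].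
Proof.
move=> ta; have l0 := lamX_gt0 n; apply/seteqP; split=> p /=.
  move=> cp; apply/(iter_union _ _ (tile_patch ta)); exists a => //.
  by rewrite scalerA mulVf ?gt_eqF // scale1r.
by move/(iter_union _ _ (tile_patch ta)) => [_ ->];
  rewrite scalerA mulVf ?gt_eqF // scale1r.
Qed.

Lemma primitive_tile a j : is_tile A a -> A j ->
  exists2 b, phi [set a] b & has_type A j b.
Proof.
move=> /tileP [i [g [Ai Gg ->]]] Aj; have [b ib jb] := subst_primitive hphi Ai Aj.
have := iter_Tt 1 Gg (alphabet_tile Ai); rewrite /= expr1 => ->.
exists (Tt (conj_dil lam g) b); first by exists b.
exact: has_type_Tt.
Qed.

(** * The space of tilings: invariance, preimages and repetitivity *)

Local Notation X := (Xphi A phi).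

Lemma Xphi_tiling x : X x -> tiling A x. Proof. by case. Qed.

Lemma TP_subset g P Q : P `<=` Q -> TP g P `<=` TP g Q.
Proof. exact: image_subset. Qed.

Lemma finite_TP g P : finite_set P -> finite_set (TP g P).
Proof. exact: finite_image. Qed.

Definition admissible P := exists n a g,
  [/\ (0 < n)%N, A a, GE g & TP g P `<=` iter n phi [set a]].

Lemma admissible_sub P Q : admissible Q -> P `<=` Q -> admissible P.
Proof.
move=> [n [a [g [n0 Aa Gg H]]]] PQ; exists n, a, g; split=> //.
by apply: subset_trans H; exact: TP_subset.
Qed.

(** A tile of type [a] occurs in [phi [set a]], so a supertile of level [n] occurs in one of level
    [n.+1]. The case [n = 0] is included, although admissibility asks for a positive level. *)
Lemma admissible_iter n a g : A a -> GE g -> admissible (TP g (iter n phi [set a])).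
Proof.
move=> Aa Gg; have [b ab [_ [k Gk bE]]] := subst_primitive hphi Aa Aa.
have Gi := GE_inv Gg; have ta := alphabet_tile Aa.
exists n.+1, a, (gmul (conj_dil (lam ^+ n) k) (ginv g)); split=> //.
  exact: GE_mul.
rewrite TP_mul -gmulA gmulVK // gmulg1 -iter_Tt // -bE iterSr.
apply: iter_mono; last by move=> _ ->.
by apply: subst_patch hphi _ _; exact: tile_patch.
Qed.

Lemma Xphi_TP x g : X x -> GE g -> X (TP g x).
Proof.
move=> [xt xf] Gg; split; first exact: tiling_TP.
move=> P fP Px; have Gi := GE_inv Gg.
have [||n [a [h [n0 Aa Gh H]]]] := xf (TP (ginv g) P).
- exact: finite_TP.
- by rewrite -(TPK x Gg); exact: TP_subset.
exists n, a, (gmul h (ginv g)); split=> //; first exact: GE_mul.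
by rewrite -TP_mul.
Qed.

Lemma Xphi_phi x : X x -> X (phi x).
Proof.
move=> [xt xf]; split; first exact: (iter_tiling 1).
move=> P fP Px; have hx := tiling_patch xt.
have /choice [f Hf] : forall c, exists a, P c -> x a /\ phi [set a] c.
  move=> c; have [Pc|nPc] := pselect (P c); last by exists c.
  by have := Px c Pc; rewrite (subst_bigcup hphi hx) => -[a xa ac]; exists a.
pose S := f @` P.
have Sx : S `<=` x by move=> _ [c Pc <-]; case: (Hf c Pc).
have fS : finite_set S by exact: finite_image.
have [n [a [g [n0 Aa Gg H]]]] := xf S fS Sx.
exists n.+1, a, (conj_dil lam g); split=> //.
have hS := patch_sub hx Sx; have ta := tile_patch (alphabet_tile Aa).
apply: (@subset_trans _ (TP (conj_dil lam g) (phi S))).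
  apply: TP_subset => c Pc; rewrite (subst_bigcup hphi hS); exists (f c).
    by exists c.
  by case: (Hf c Pc).
rewrite -(subst_equiv hphi Gg hS) /=.
by apply: subst_mono => //; exact: iter_patch.
Qed.

Lemma Xphi_iter n x : X x -> X (iter n phi x).
Proof. by move=> Xx; elim: n => //= n; exact: Xphi_phi. Qed.

Lemma finite_powerset (T : choiceType) (F : set T) : finite_set F ->
  finite_set [set G : set T | G `<=` F].
Proof.
move=> /finite_seqP [s ->].
pose f (w : {ffun 'I_(size s) -> bool}) : set T :=
  [set z | exists i : 'I_(size s), w i /\ z = tnth (in_tuple s) i].
apply: (@sub_finite_set _ _ (f @` setT)); last by apply: finite_image;
  exact: finite_finset.
move=> G GF; exists [ffun i => `[< G (tnth (in_tuple s) i) >]] => //.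
apply/seteqP; split=> z.
  by move=> [i []]; rewrite ffunE => /asboolP H ->.
move=> Gz; have zs : z \in s by exact: (GF z Gz).
have zi : (index z s < size s)%N by rewrite index_mem.
have E : z = tnth (in_tuple s) (Ordinal zi) by rewrite (tnth_nth z) /= nth_index.
by exists (Ordinal zi); rewrite ffunE; split=> //; apply/asboolP; rewrite -E.
Qed.

(* The preimage is the ultralimit of patches w_R whose images contain the tiles
   of x that meet the ball of radius R. *)
Lemma Xphi_surj x : X x -> exists2 x', X x' & x = phi x'.
Proof.
move=> [xt xf]; have l0 := lam_gt0.
have li : lam != 0 by rewrite gt_eqF.
pose S (n : nat) := [set a | x a /\ exists2 p, a p & enorm p <= n%:R].
have /choice [w Hw] : forall n, exists w, [/\ is_patch A w,
  admissible w & S n `<=` phi w].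
  move=> n; have [||N [a [g [N0 Aa Gg H]]]] := xf (S n).
  - exact: (tiling_locally_finite hA).
  - by move=> a [xa _].
  case: N N0 H => // N _ H; have Gi := GE_inv Gg.
  have ha := tile_patch (alphabet_tile Aa).
  exists (TP (conj_dil lam^-1 (ginv g)) (iter N phi [set a])); split.
  - by apply: patch_TP => //; exact: iter_patch.
  - exact: admissible_iter.
  - rewrite (subst_equiv hphi) //; last exact: iter_patch.
    by rewrite conj_dil_comp divff // conj_dil1 -[S n](TPK _ Gg); exact: TP_subset.
have hw n : is_patch A (w n) by case: (Hw n).
have Sw n : S n `<=` phi (w n) by case: (Hw n).
(* The tile of [x] at [q] belongs to [phi (w n)], a patch, where it cannot differ from [d]. *)
have inx n b d q : w n b -> phi [set b] d -> d° q -> enorm q <= n%:R -> x d.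
  move=> wb bd dq qn; have [e xe eq] := tiling_cover q xt.
  have hwn := subst_patch hphi (hw n).
  suff -> : d = e by [].
  apply: (patch_eq hwn _ _ dq eq).
    by rewrite (subst_bigcup hphi (hw n)); exists b.
  by apply: Sw; split=> //; exists q.
have [U UU Un] := free_ultrafilter.
have PU := ultra_filter_proper UU.
pose x' := [set b | \forall n \near U, w n b].
have ex2 b (Q : set nat) : x' b -> U Q -> exists n, w n b /\ Q n.
  by move=> x'b UQ; exact: (@filter_ex _ U _ _ (@filterI _ U _ _ _ x'b UQ)).
have ex1 b : x' b -> exists n, w n b.
  by move=> x'b; exact: (@filter_ex _ U _ _ x'b).
have x'x b : x' b -> phi [set b] `<=` x.
  move=> x'b d bd.
  have [n wb] := ex1 _ x'b.
  have td : is_tile A d.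
    apply: (patch_tile (P := phi (w n))); first exact: subst_patch hphi _ (hw n).
    by rewrite (subst_bigcup hphi (hw n)); exists b.
  have [q dq] := tile_interior hA td.
  have [k [wk /= kn]] := ex2 _ _ x'b (Un (Num.truncn (enorm q)).+1).
  apply: inx wk bd dq _; apply/ltW/(lt_le_trans (truncnS_gt _)).
  by rewrite ler_nat.
have xx' c : x c -> exists2 b, x' b & phi [set b] c.
  move=> xc; have tc := tiling_tile xt xc.
  have [q /interior_subset cq] := tile_interior hA tc.
  have [D D0 HD] := tile_diam hA.
  (* The parent of [c] has diameter at most [D], so every tile of its image has its points within
     [lam * D] of [q]. *)
  pose l := enorm q + lam * D.
  pose F := [set a | x a /\ exists2 p, a p & enorm p <= l].
  have fF : finite_set F by exact: (tiling_locally_finite hA).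
  pose N := (Num.truncn l).+1.
  have lN n : (N <= n)%N -> l <= n%:R.
    by move=> Nn; apply/ltW/(lt_le_trans (truncnS_gt _)); rewrite ler_nat.
  have /choice [f Hf] : forall n, exists b, (N <= n)%N -> w n b /\ phi [set b] c.
    move=> n; have [Nn|nN] := leqP N n; last by exists c.
    have : phi (w n) c.
      apply: Sw; split=> //; exists q => //; apply: le_trans (lN _ Nn).
      by rewrite lerDl mulr_ge0 ?(ltW l0) ?(ltW D0).
    by rewrite (subst_bigcup hphi (hw n)) => -[b wb bc]; exists b.
  have tf n : (N <= n)%N -> is_tile A (f n).
    by move=> /Hf [wf _]; exact: patch_tile (hw n) wf.
  (* The image of the parent [f n] is a subset of the finite set [F] and determines [f n]: there are
     finitely many candidates, and the ultrafilter selects one. *)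
  have [||b Fb fb] := @ultra_finite U UU _ [set b | is_tile A b /\ phi [set b]
    `<=` F] f.
  - apply: (@sub_finite_set _ _
      ((fun G : set (set 'cV[R]_m) =>
        [set p | exists2 d, G d & d (lam ^+ 1 *: p)]) @`
         [set G | G `<=` F])).
      move=> b [tb bF]; exists (phi [set b]) => //; exact/esym/(tile_of_supertile 1).
    exact/finite_image/finite_powerset.
  - apply: filterS (Un N) => n /= Nn; split; first exact: tf.
    have [wf fc] := Hf n Nn => d fd.
    have mem e : phi [set f n] e -> forall p, e p -> f n (lam^-1 *: p).
      move=> fe p ep; have [|_ -> //] := (iter_union 1 p (tile_patch (tf n Nn))).1 _.
        by exists e.
    have td : is_tile A d.
      apply: (patch_tile (P := phi (w n))); first exact: subst_patch hphi _ (hw n).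
      by rewrite (subst_bigcup hphi (hw n)); exists (f n).
    have [p dp] := tile_interior hA td; have dp' := interior_subset dp.
    have pl : enorm p <= l.
      rewrite -(subrK q p) addrC; apply: le_trans (enormD _ _) _.
      rewrite lerD2l -[p - q](scalerKV li) enormZ gtr0_norm // ler_wpM2l ?(ltW
        l0) //.
      rewrite scalerBr; apply: (HD (f n) _ _ (tf n Nn)); first exact: mem fd _ dp'.
      exact: mem fc _ cq.
    split; last by exists p.
    by apply: (inx n _ _ _ wf fd dp); apply: le_trans pl (lN n Nn).
  exists b.
    apply: filterS (filterI fb (Un N)) => n [/= <- Nn]; by case: (Hf n Nn).
  have [n [/= <- Nn]] := filter_ex (filterI fb (Un N)).
  by case: (Hf n Nn).
have x't : tiling A x'.
  split.
  - by move=> b x'b; have [n wb] := ex1 _ x'b; exact: patch_tile (hw n) wb.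
  - apply/seteqP; split=> // p _; have [c xc cp] := tiling_cover (lam *: p) xt.
    have [b x'b bc] := xx' c xc; exists b => //.
    have [n wb] := ex1 _ x'b.
    have tb := patch_tile (hw n) wb.
    have [|_ ->] := (iter_union 1 (lam *: p) (tile_patch tb)).1 _; first by exists c.
    by rewrite expr1 scalerK.
  - move=> b b' x'b x'b' [p [bp b'p]].
    have [n [wb wb']] := ex2 _ _ x'b x'b'.
    exact: patch_eq (hw n) wb wb' bp (interior_subset b'p).
exists x'.
  split=> // P /finite_seqP [s ->] sx'.
  have : \forall n \near U, forall b, b \in s -> w n b.
    elim: s sx' => [|b s IH] H; first by apply: filterE.
    have H1 : x' b by apply: H; rewrite /= mem_head.
    have H2 : \forall n \near U, forall b, b \in s -> w n b.
      by apply: IH => c cs; apply: H; rewrite /= inE; apply/orP; right.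
    apply: (@filterS _ U _ _ _ _ (@filterI _ U _ _ _ H1 H2)) => n [wb ws] c;
      rewrite inE => /orP[/eqP -> //|].
    exact: ws.
  move=> /filter_ex [n ws]; have [_ aw _] := Hw n.
  exact: admissible_sub aw ws.
rewrite (subst_bigcup hphi (tiling_patch x't)); apply/seteqP; split.
  by move=> c /xx' [b x'b bc]; exists b.
by move=> c [b x'b bc]; exact: x'x bc.
Qed.

Lemma Xphi_surj_iter n x : X x -> exists2 x', X x' & x = iter n phi x'.
Proof.
elim: n x => [|n IH] x Xx; first by exists x.
have [x1 Xx1 ->] := Xphi_surj Xx; have [x2 Xx2 ->] := IH x1 Xx1.
by exists x2.
Qed.

Lemma Xphi_has_type x j : X x -> A j -> exists2 a, x a & has_type A j a.
Proof.
move=> Xx Aj; have [x' Xx' ->] := Xphi_surj Xx.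
have x't := Xphi_tiling Xx'; have [a xa _] := tiling_cover 0 x't.
have [b ab jb] := primitive_tile (tiling_tile x't xa) Aj; exists b => //.
by rewrite (subst_bigcup hphi (tiling_patch x't)); exists a.
Qed.

(** [P] fits in a supertile of some level [n] and type [a]; write [y] as the [n]-th image of some
    [y'] and take a tile of type [a] in [y']. *)
Lemma Xphi_repetitive x y P : X x -> X y -> finite_set P -> P `<=` x ->
  exists2 g, GE g & TP g P `<=` y.
Proof.
move=> [xt xf] Xy fP Px; have [n [a [g [n0 Aa Gg H]]]] := xf P fP Px.
have [y' Xy' ->] := Xphi_surj_iter n Xy.
have [b yb [_ [h Gh bE]]] := Xphi_has_type Xy' Aa.
exists (gmul (conj_dil (lam ^+ n) h) g); first exact: GE_mul.
have hy := tiling_patch (Xphi_tiling Xy').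
rewrite -TP_mul; apply: (subset_trans (TP_subset H)).
rewrite -iter_Tt -?bE //; last exact: alphabet_tile.
by apply: iter_mono => // _ ->.
Qed.

(** * Motions between tiles of a tiling and the groups O_j *)

Lemma Oj_mem x j g a b : x a -> x b -> has_type A j b -> GE g -> a = Tt g b ->
  Oj A j x g.1.
Proof.
move=> xa xb jb Gg aE; apply: SO_gen_incl; exists a.
  by split=> //; rewrite aE; exact: has_type_Tt.
split=> //; exists b; split=> //; exists g.2; rewrite Tt_comp /= !mul1mx add0r aE.
by case: g {Gg aE}.
Qed.

Lemma Oj_sub x j (H : set 'M[R]_m) : SO_subgroup H ->
  (forall g a b, x a -> x b -> has_type A j b -> GE g -> a = Tt g b -> H g.1) ->
  Oj A j x `<=` H.
Proof.
move=> sH HH; apply: smallest_sub => // r [a [xa ja] [Sr [b [xb jb [t aE]]]]].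
apply: (HH (r, t) a b) => //; rewrite aE Tt_comp /= !mul1mx add0r //.
Qed.

Lemma Oj_SO x j : SO_subgroup (Oj A j x).
Proof. by apply: SO_gen_subgroup => r [a _ []]. Qed.

Lemma subgroup_tr (H : set 'M[R]_m) r : SO_subgroup H -> H r -> H r^T.
Proof. by move=> [HS _ _ HV] Hr; rewrite -SO_invE; [exact: HV|exact: HS]. Qed.

(** A motion [k] carries [a] together with the pair [c], [d] into [y], which puts the conjugate of
    the rotation of [g] by that of [k] in the group. As [y] contains both [Tt k a] and the translate
    [b] of [a], the rotation of [k] is in the group too, and the conjugation can be undone. *)
Lemma Oj_sub_parallel x y j a b : X x -> X y -> x a -> y b -> has_type A j a ->
  parallel a b -> Oj A j x `<=` Oj A j y.
Proof.
move=> Xx Xy xa yb ja [t bE]; have sH := Oj_SO y j; have [_ _ HM _] := sH.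
apply: Oj_sub => // g c d xc xd jd Gg cE.
have [||k Gk Hk] := @Xphi_repetitive x y [set a; c; d] Xx Xy.
- by rewrite !finite_setU; repeat split; exact: finite_set1.
- by move=> _ [[]|] ->.
have yk e : [set a; c; d] e -> y (Tt k e) by move=> He; apply: Hk; exists e.
have Gki := GE_inv Gk; have G1 : GE ((1%:M, t) : motion R m) by exact: SO_1.
have ka : Oj A j y k.1.
  have -> : k.1 = (gmul k (ginv (1%:M, t))).1 by rewrite /= trmx1 mulmx1.
  apply: (@Oj_mem _ _ _ (Tt k a) b) => //.
  - by apply: yk; left; left.
  - by rewrite bE; exact: has_type_Tt.
  - by apply: GE_mul => //; exact: GE_inv.
  - by rewrite bE -Tt_mul TtK.
have kc : Oj A j y (k.1 *m g.1 *m k.1^T).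
  have -> : k.1 *m g.1 *m k.1^T = (gmul (gmul k g) (ginv k)).1 by [].
  apply: (@Oj_mem _ _ _ (Tt k c) (Tt k d)) => //.
  - by apply: yk; left; right.
  - by apply: yk; right.
  - exact: has_type_Tt.
  - by do 2?apply: GE_mul.
  - by rewrite -Tt_mul TtK // -Tt_mul -cE.
have : Oj A j y (k.1^T *m (k.1 *m g.1 *m k.1^T) *m k.1).
  exact: (HM _ _ (HM _ _ (subgroup_tr sH ka) kc) ka).
by rewrite !mulmxA SO_mulVmx // mul1mx -mulmxA SO_mulVmx // mulmx1.
Qed.

Lemma parallel_sym a b : parallel a b -> parallel b a.
Proof.
by move=> [t ->]; exists (- t); rewrite Tt_comp /= !mul1mx subrr Tt_id.
Qed.

Lemma Oj_parallel x y j a b : X x -> X y -> x a -> y b -> has_type A j a ->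
  parallel a b -> Oj A j x = Oj A j y.
Proof.
move=> Xx Xy xa yb ja ab; apply/seteqP; split; first exact: Oj_sub_parallel ab.
apply: (Oj_sub_parallel Xy Xx yb xa _ (parallel_sym ab)).
by have [t ->] := ab; apply: has_type_Tt => //; exact: SO_1.
Qed.

Definition SO_conjugate (r : 'M[R]_m) (H : set 'M[R]_m) : set 'M[R]_m :=
  [set r *m h *m invmx r | h in H].

Lemma SO_conjugate_subgroup r H : SO r -> SO_subgroup H ->
  SO_subgroup (SO_conjugate r H).
Proof.
move=> Sr sH; have [HS H1 HM HV] := sH; have ri := SO_invE Sr; split.
- by move=> _ [h Hh <-]; rewrite ri; do 2?apply: SO_mul;
  [| exact: HS | exact: SO_tr].
- by exists 1%:M => //; rewrite mulmx1 ri SO_mulmxV.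
- move=> _ _ [h Hh <-] [k Hk <-]; exists (h *m k); first exact: HM.
  by rewrite !mulmxA -(mulmxA (r *m h) _ r) mulVmx ?mulmx1 // SO_unit.
- move=> _ [h Hh <-]; exists (invmx h); first exact: HV.
  have Sh := HS _ Hh; rewrite ri !SO_invE //; last by do 2?apply: SO_mul => //;
    exact: SO_tr.
  by rewrite !trmx_mul trmxK mulmxA.
Qed.

Lemma Oj_TP x j g : GE g -> Oj A j (TP g x) = SO_conjugate g.1 (Oj A j x).
Proof.
have sub x1 k : GE k -> SO_conjugate k.1 (Oj A j x1) `<=` Oj A j (TP k x1).
  move=> Gk; have Gi := GE_inv Gk; have Sk : SO k.1 := Gk.
  have sH := Oj_SO (TP k x1) j.
  have H : Oj A j x1 `<=` SO_conjugate k.1^T (Oj A j (TP k x1)).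
    apply: Oj_sub; first by apply: SO_conjugate_subgroup => //; exact: SO_tr.
    move=> h a b xa xb jb Gh aE; exists (k.1 *m h.1 *m k.1^T).
      have -> : k.1 *m h.1 *m k.1^T = (gmul (gmul k h) (ginv k)).1 by [].
      apply: (@Oj_mem _ _ _ (Tt k a) (Tt k b)) => //.
      + by exists a.
      + by exists b.
      + exact: has_type_Tt.
      + by do 2?apply: GE_mul.
      + by rewrite -Tt_mul TtK // -Tt_mul aE.
    rewrite SO_invE ?trmxK; last exact: SO_tr.
    by rewrite !mulmxA SO_mulVmx // mul1mx -mulmxA SO_mulVmx // mulmx1.
  move=> _ [h /H [h' Oh' <-] <-]; rewrite (SO_invE Sk) (SO_invE (SO_tr Sk)) trmxK.
  by rewrite !mulmxA SO_mulmxV // mul1mx -mulmxA SO_mulmxV // mulmx1.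
move=> Gg; have Gi := GE_inv Gg; apply/seteqP; split; last exact: sub.
move=> r Hr; have : Oj A j x (g.1^T *m r *m g.1).
  rewrite -(TPK x Gg); apply: (sub _ (ginv g)) => //; exists r => //.
  by rewrite SO_invE ?trmxK //; exact: SO_tr.
move=> H; exists (g.1^T *m r *m g.1) => //; rewrite SO_invE //.
by rewrite !mulmxA SO_mulmxV // mul1mx -mulmxA SO_mulmxV // mulmx1.
Qed.

Lemma Oj_conj x y j : X x -> X y -> A j -> SO_conj (Oj A j x) (Oj A j y).
Proof.
move=> Xx Xy Aj; have [a xa ja] := Xphi_has_type Xx Aj.
have [b yb jb] := Xphi_has_type Xy Aj.
have [r Sr rab] := has_type_rot ja jb.
have Gr : GE ((r, 0) : motion R m) by [].
exists r => //; rewrite -[RHS](Oj_TP x j Gr).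
apply/esym/(Oj_parallel (Xphi_TP Xx Gr) Xy _ yb _ rab); first by exists a.
exact: has_type_Tt.
Qed.

(** [conj_dil lam g] has the rotation of [g] and carries the image of [b] onto that of [a]; by
    primitivity these images contain tiles of every type. *)
Lemma Oj_phi x i j : X x -> A i -> A j -> Oj A j x `<=` Oj A i (phi x).
Proof.
move=> Xx Ai Aj; have hx := tiling_patch (Xphi_tiling Xx).
apply: Oj_sub; first exact: Oj_SO.
move=> g a b xa xb jb Gg aE; have tb := has_type_is_tile jb.
have [c bc ic] := primitive_tile tb Ai.
apply: (@Oj_mem _ _ (conj_dil lam g) (Tt (conj_dil lam g) c) c) => //.
  rewrite (subst_bigcup hphi hx); exists a => //.
  have := iter_Tt 1 Gg tb; rewrite /= expr1 aE => ->; by exists c.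
by rewrite (subst_bigcup hphi hx); exists b.
Qed.

Lemma Oj_iter n x i j : X x -> A i -> A j -> (0 < n)%N ->
  Oj A j x `<=` Oj A i (iter n phi x).
Proof.
move=> Xx Ai Aj; case: n => // n _; elim: n => [|n IH]; first exact: Oj_phi.
by apply: (subset_trans IH); apply: Oj_phi => //; exact: Xphi_iter.
Qed.

Lemma Oj_self_parallel x j : self_parallel A phi -> X x -> A j ->
  exists n, (0 < n)%N /\ forall l, Oj A j (iter (n * l) phi x) = Oj A j x.
Proof.
move=> sp Xx Aj; have [n [b [n0 jb tb [t bE]]]] := sp j Aj.
exists n; split=> //; elim=> [|l <-]; first by rewrite muln0.
rewrite mulnS iterD; set y := iter (n * l) phi x.
have Xy : X y by exact: Xphi_iter.
have [a ya ja] := Xphi_has_type Xy Aj; have [_ [g Gg aE]] := ja.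
have hy := tiling_patch (Xphi_tiling Xy).
apply/esym; apply: (Oj_parallel Xy (Xphi_iter n Xy) ya (b :=
  Tt (conj_dil (lam ^+ n) g) b)) => //.
  rewrite iter_bigcup //; exists a => //; rewrite aE iter_Tt //; first by exists b.
  exact: alphabet_tile.
exists (g.1 *m t + lam ^+ n *: g.2 - g.2); rewrite aE bE !Tt_comp /=.
by rewrite !mul1mx mulmx1 [g.2 + _]addrC subrK.
Qed.

Lemma Oj_self_parallel_eq x n i j : self_parallel A phi -> X x -> A i -> A j ->
  Oj A i (iter n phi x) = Oj A j x.
Proof.
move=> sp.
have pos y k i' j' : (0 < k)%N -> X y -> A i' -> A j' ->
  Oj A i' (iter k phi y) = Oj A j' y.
  move=> k0 Xy Ai Aj; apply/seteqP; split; last exact: Oj_iter.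
  have [l [l0 Hl]] := Oj_self_parallel sp Xy Aj.
  (* The group at level [k] lies between those at levels 0 and [l * k.+1], which are equal. With
     [k.+1] the remaining number of steps is positive, as the change of type in [Oj_iter]
     requires. *)
  rewrite -[X in _ `<=` X](Hl k.+1) (_ : (l * k.+1 = (l * k.+1 - k) + k)%N);
    last first.
    by rewrite subnK // (leq_trans (leqnSn k)) // leq_pmull.
  rewrite iterD; apply: Oj_iter => //; first exact: Xphi_iter.
  by rewrite subn_gt0; exact: leq_pmull.
case: n => [|n] Xx Ai Aj; last exact: pos.
(* At level 0 only the type changes: both groups equal a group of a preimage. *)
have [y Xy ->] := Xphi_surj Xx.
by rewrite /= (pos y 1%N i i) // (pos y 1%N j i).
Qed.

End Substitution.

(** * The contracting set *)

Section Contraction.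
Context {R : realType} {m : nat}.
Variables (A : set (set 'cV[R]_m)) (faces : set 'cV[R]_m -> set (set 'cV[R]_m)).
Hypothesis hA : alphabet A faces.
Variables (phi : set (set 'cV[R]_m) -> set (set 'cV[R]_m)) (lam : R).
Hypothesis hphi : substitution A faces phi lam.
Implicit Types (p q : 'cV[R]_m) (g h : motion R m) (a b c : set 'cV[R]_m).
Implicit Types (x y P Q : set (set 'cV[R]_m)).
Local Notation X := (Xphi A phi).

(** * Agreement on a large ball, and the lower bound for [Oeps] *)

Lemma tdist_ge0 x y : (0 <= tdist x y)%E.
Proof.
apply: (@le_trans _ _ ((1%:R^-1)%:E * hausdorff_dist (eball 1%:R `&` tiling_bnd x)
    (eball 1%:R `&` tiling_bnd y))%E).
  rewrite mule_ge0 ?lee_fin ?invr_ge0 ?ler01 //.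
  by rewrite /hausdorff_dist le_max lexx.
by apply: ereal_sup_ubound; exists 1%N.
Qed.

(** For [n] up to [rho] the boundaries in the ball are the same. For larger [n] any boundary point
    has one of the other tiling within [2 * D], and the factor [1/n] in the metric brings this below
    [2 * D / rho]. *)
Lemma tdist_agree : exists2 C : R, 0 < C & forall (rho : R) x y, C <= rho ->
  tiling A x -> tiling A y ->
  (forall p, enorm p <= rho -> tiling_bnd x p <-> tiling_bnd y p) ->
  (tdist x y <= (C / rho)%:E)%E.
Proof.
have [D D0 HD] := tile_diam hA.
exists (2 * D) => [|rho x y Cr xt yt xy]; first by rewrite mulr_gt0.
have r0 : 0 < rho by apply: lt_le_trans Cr; rewrite mulr_gt0.
have one x1 y1 : tiling A x1 -> tiling A y1 ->
    (forall p, enorm p <= rho -> tiling_bnd x1 p -> tiling_bnd y1 p) ->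
    forall n p, (0 < n)%N -> enorm p <= n%:R -> tiling_bnd x1 p ->
    exists q, [/\ enorm q <= n%:R,
      tiling_bnd y1 q & enorm (p - q) <= n%:R * (2 * D / rho)].
  move=> x1t y1t xy1 n p n0 pn x1p.
  have nR : 0 < n%:R :> R by rewrite ltr0n.
  have [nr|rn] := leP n%:R rho.
    exists p; split=> //; first by apply: xy1 => //; exact: le_trans nr.
    by rewrite subrr enorm0 !mulr_ge0 ?invr_ge0 ?ltW.
  (* [p] is pulled in by at most [D], so that a boundary point of the tile at [c0] is still in the
     ball of radius [n]. *)
  pose c0 := (1 - D / n%:R) *: p.
  have Dn : D / n%:R <= 1 by rewrite ler_pdivrMr //; lra.
  have Dn0 : 0 <= D / n%:R by rewrite divr_ge0 // ltW.
  have c0n : enorm c0 <= n%:R - D.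
    rewrite enormZ ger0_norm; last by rewrite subr_ge0.
    have -> : n%:R - D = (1 - D / n%:R) * n%:R by rewrite mulrBl mul1r divfK //
      gt_eqF.
    by rewrite ler_wpM2l // subr_ge0.
  have pc0 : enorm (p - c0) <= D.
    rewrite /c0 scalerBl scale1r opprB addrC subrK enormZ ger0_norm //.
    by rewrite mulrAC ler_pdivrMr // ler_wpM2l // ltW.
  have [e ye ec0] := tiling_cover c0 y1t.
  have te := tiling_tile y1t ye.
  (* A direction in which to leave the tile [e]; the existence of a boundary point excludes
     dimension 0. *)
  have [v v0] : exists v : 'cV[R]_m, v != 0.
    have [c xc [_ ncp]] := x1p.
    have [z cz] := tile_interior hA (tiling_tile x1t xc).
    by exists (z - p); rewrite subr_eq0; apply/eqP => zp; apply: ncp; rewrite -zp.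
  have vn : 0 < enorm v.
    by rewrite lt_neqAle enorm_ge0 andbT eq_sym; apply: contra_neq v0 => /enorm0_eq0.
  have [|q [eq _]] := @segment_meets_bnd _ _ e c0 (c0 + (2 * D / enorm v) *: v) ec0.
    move=> /(HD e _ c0 te) /(_ ec0); rewrite addrAC subrr add0r enormZ.
    rewrite ger0_norm ?divr_ge0 ?mulr_ge0 ?enorm_ge0 ?(ltW D0) //.
    by rewrite divfK ?gt_eqF //; lra.
  have qc0 : enorm (q - c0) <= D.
    by apply: HD ec0 => //; exact: (bnd_tile hA).
  exists q; split; last 1 first.
  - have := enorm_tri p c0 q; rewrite (enormB c0 q) => H.
    apply: (@le_trans _ _ (2 * D)); first lra.
    by rewrite mulrCA ler_peMr ?mulr_ge0 ?(ltW D0) // ler_pdivlMr // mul1r ltW.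
  - by have := enormD (q - c0) c0; rewrite subrK; lra.
  - by exists e.
apply: tdist_le; first by rewrite !mulr_ge0 ?invr_ge0 ?ltW.
  by apply: one => // p pr; apply: (xy p pr).1.
by apply: one => // p pr; apply: (xy p pr).2.
Qed.

Lemma bnd_agree x y P p : tiling A x -> P `<=` x -> P `<=` y ->
  (exists2 c, P c & c p) -> tiling_bnd x p -> tiling_bnd y p.
Proof.
move=> xt Px Py [c Pc cp] xp; exists c; first exact: Py.
split; first exact: subset_closure.
by move=> cip; apply: (tiling_bnd_interior hA xt (Px _ Pc) cip).
Qed.

Lemma Seps_agree (eps : R) : 0 < eps -> exists rho0 : R,
  forall rho x P g, rho0 <= rho -> X x -> P `<=` x ->
  (forall p, enorm p <= rho -> exists2 c, P c & c p) ->
  GE g -> P `<=` TP g x -> Seps A phi eps x (TP g x).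
Proof.
move=> e0; have [C C0 HC] := tdist_agree.
have l1 := lam_gt1 hphi; have l0 := lam_gt0 hphi.
(* [C] meets the requirement of [tdist_agree], [C / eps] brings the distance down to [eps], and 1
   makes this strict. *)
exists (C + C / eps + 1) => rho x P g rr Xx Px HP Gg Pgx.
have Ce : 0 < C / eps by rewrite divr_gt0.
have r0 : 0 < rho by lra.
have xt := Xphi_tiling Xx.
have hP := patch_sub (tiling_patch xt) Px.
have Xgx := Xphi_TP Xx Gg.
have dle n : (tdist (iter n phi (TP g x)) (iter n phi x) <= (C / rho * lam^-1
  ^+ n)%:E)%E.
  have ln : 1 <= lam ^+ n by rewrite exprn_ege1 // ltW.
  have -> : C / rho * lam^-1 ^+ n = C / (rho * lam ^+ n).
    by rewrite invfM exprVn mulrA.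
  apply: HC.
  - apply: (@le_trans _ _ rho); first lra.
    by rewrite ler_peMr // ltW.
  - by apply: (iter_tiling hphi); exact: Xphi_tiling Xgx.
  - exact: (iter_tiling hphi).
  - move=> p pr.
    have cov : exists2 c, iter n phi P c & c p.
      apply/(iter_union hphi _ _ hP); apply: HP; rewrite enormZ.
      rewrite ger0_norm ?invr_ge0 ?(ltW (lamX_gt0 hphi n)) //.
      by rewrite mulrC ler_pdivrMr ?(lamX_gt0 hphi).
    have sx : iter n phi P `<=` iter n phi x by apply: (iter_mono hphi) => //;
      exact: tiling_patch.
    have sgx : iter n phi P `<=` iter n phi (TP g x).
      by apply: (iter_mono hphi) => //; exact: tiling_patch (Xphi_tiling Xgx).
    split; first by apply: (bnd_agree _ sgx sx cov); apply: (iter_tiling hphi);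
      exact: Xphi_tiling Xgx.
    by apply: (bnd_agree _ sx sgx cov); exact: (iter_tiling hphi).
split=> //.
- move=> n; apply: le_lt_trans (dle n) _; rewrite lte_fin.
  apply: (@le_lt_trans _ _ (C / rho)).
    rewrite ler_piMr ?divr_ge0 ?(ltW C0) ?(ltW r0) // exprVn invf_le1.
      by rewrite exprn_ege1 // ltW.
    exact: (lamX_gt0 hphi).
  rewrite ltr_pdivrMr // mulrC -ltr_pdivrMr //; lra.
- apply: (@squeeze_cvge _ _ _ _ (fun=> 0%E) _ (fun n =>
  (geometric (C / rho) lam^-1 n)%:E)).
  + by apply: filterE => n; rewrite tdist_ge0 /=; exact: dle.
  + exact: cvg_cst.
  + apply: cvg_EFin; first exact: filterE.
    apply: (@cvg_geometric _ (C / rho) lam^-1).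
    by rewrite ger0_norm ?invr_ge0 ?(ltW l0) // invf_lt1.
Qed.

Lemma has_type_GE j a b : has_type A j a -> has_type A j b -> exists2 g,
  GE g & b = Tt g a.
Proof.
move=> [_ [g Gg ->]] [_ [h Gh ->]]; exists (gmul h (ginv g)).
  by apply: GE_mul => //; exact: GE_inv.
by rewrite -Tt_mul TtK.
Qed.

Lemma Reps_SO eps x : Reps A phi eps x `<=` SO.
Proof. by move=> r []. Qed.

Lemma Oj_sub_Oeps (eps : R) : 0 < eps -> exists rho : R,
  forall k x' j a, X x' -> has_type A j a -> iter k phi [set a] `<=` iter k phi x' ->
  (forall p, enorm p <= rho -> exists2 c, iter k phi [set a] c & c p) ->
  Oj A j x' `<=` Oeps A phi eps (iter k phi x').
Proof.
move=> e0; have [rho Hrho] := Seps_agree e0.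
exists rho => k x' j a Xx' ja Px HP; set x := iter k phi x' in Px *.
have ta := has_type_is_tile ja.
have x't := Xphi_tiling Xx'; have hx' := tiling_patch x't.
have Xx : X x by apply: (Xphi_iter hphi).
have sH : SO_subgroup (Oeps A phi eps x) by apply: SO_gen_subgroup; exact: Reps_SO.
have [_ _ HM _] := sH.
have key b g : x' b -> GE g -> b = Tt g a -> Oeps A phi eps x g.1.
  move=> xb Gg bE; pose h := conj_dil (lam ^+ k) g.
  have Gh : GE h by []; have Gi := GE_inv Gh.
  have sub : iter k phi [set a] `<=` TP (ginv h) x.
    rewrite -[iter k phi [set a]](TPK _ Gh); apply: TP_subset.
    by rewrite -(iter_Tt hphi) // -bE; apply: (iter_mono hphi) => // _ ->.
  have : Oeps A phi eps x (ginv h).1.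
    apply: SO_gen_incl; split; first exact: Gi.
    by exists (ginv h).2; exact: (Hrho rho x _ (ginv h) (lexx _) Xx Px HP Gi sub).
  by move/(subgroup_tr sH); rewrite /= trmxK.
apply: Oj_sub => // g b c xb xc jc Gg bE.
(* [key] only reaches motions starting from [a]; one between two arbitrary tiles is a quotient of
   two such motions. *)
have [h Gh cE] := has_type_GE ja jc.
have H1 := key c h xc Gh cE.
have H2 : Oeps A phi eps x (gmul g h).1.
  by apply: (key b) => //; [exact: GE_mul|rewrite -Tt_mul -cE].
have := HM _ _ H2 (subgroup_tr sH H1); rewrite /= -mulmxA SO_mulmxV //.
by rewrite mulmx1.
Qed.

(** * Motions close to the identity, and the upper bound for [Oeps] *)

Lemma close_motions_eq : exists2 d : R, 0 < d & forall y c g h (e e' : R),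
  tiling A y ->
  is_tile A c -> GE g -> GE h -> y (Tt g c) -> y (Tt h c) -> e + e' < d ->
  (forall p, c p -> enorm (move g p - p) < e) ->
  (forall p, c p -> enorm (move h p - p) < e') -> g = h.
Proof.
have [d d0 Hd] := tile_rigid hA; have [r r0 Hr] := tile_inball hA.
exists (Num.min d r); first by rewrite lt_min d0 r0.
move=> y c g h e e' yt tc Gg Gh yg yh; rewrite lt_min => /andP[ed er] He He'.
have [z Hz] := Hr c tc.
have cz : c z by apply: Hz; rewrite subrr enorm0.
have e'0 : 0 < e' by apply: le_lt_trans (He' z cz); exact: enorm_ge0.
have e0 : 0 < e by apply: le_lt_trans (He z cz); exact: enorm_ge0.
have inz k (t : R) : GE k -> t < r -> (forall p,
  c p -> enorm (move k p - p) < t) -> (Tt k c)° z.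
  move=> Gk tr Hk; apply/interior_enormP; exists (r - t); first by rewrite subr_gt0.
  move=> q qz; apply/TtE => //; apply: Hz.
  rewrite -(move_iso _ _ Gk) moveVK //; apply: le_lt_trans (enorm_tri _ z _) _.
  by rewrite (enormB z); have := Hk z cz; lra.
(* Both images have the centre [z] of the inscribed ball in their interior, so they are the same
   tile. Then [g] followed by [ginv h] is a small symmetry of [c], hence trivial. *)
have E : Tt g c = Tt h c.
  apply: (tiling_eq hA yt yg yh (p := z)); first by apply: inz He => //; lra.
  by apply: interior_subset; apply: inz He' => //; lra.
have Gi := GE_inv Gh.
have : gmul (ginv h) g = (1%:M, 0).
  apply: Hd tc _ _ _; first exact: GE_mul.
    by rewrite -Tt_mul E TtK.
  move=> p cp; rewrite move_mul -(move_iso _ _ Gh) moveVK //.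
  have := enorm_tri (move g p) p (move h p); rewrite (enormB p).
  by have := He p cp; have := He' p cp; lra.
by move=> H; rewrite -(gmul1 g) -(gmulKV Gh) -gmulA H gmulg1.
Qed.

(** A segment in direction [p], scaled to fit in the ball inscribed in [c], is turned by the
    rotation of [g], and its two ends move by less than [e]. This transfers control of a rotation
    from [c] to any tile at the origin. *)
Lemma rotation_displacement : exists2 K : R, 0 < K & forall c g (e : R),
  is_tile A c ->
  (forall p, c p -> enorm (move g p - p) < e) ->
  forall b p, is_tile A b -> b 0 -> b p -> enorm (g.1 *m p - p) <= K * e.
Proof.
have [D D0 HD] := tile_diam hA; have [r r0 Hr] := tile_inball hA.
exists (4 * D / r) => [|c g e tc He b p tb b0 bp];
  first by rewrite divr_gt0 // mulr_gt0.
have [z Hz] := Hr c tc.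
have cz : c z by apply: Hz; rewrite subrr enorm0.
pose t := r / (2 * D).
have t0 : 0 < t by rewrite divr_gt0 // mulr_gt0.
have cv : c (z + t *: p).
  apply: Hz; rewrite addrAC subrr add0r enormZ gtr0_norm //.
  have pD : enorm p <= D by rewrite -[p]subr0; exact: HD bp b0.
  apply: (@le_lt_trans _ _ (t * D)); first by rewrite ler_wpM2l // ltW.
  have -> : t * D = r / 2 by rewrite /t; field; rewrite gt_eqF.
  lra.
have : enorm (t *: (g.1 *m p - p)) < 2 * e.
  have -> : t *: (g.1 *m p - p) =
      (move g (z + t *: p) - (z + t *: p)) - (move g z - z).
    rewrite /move mulmxDr -scalemxAr scalerBr; apply/colP => i; rewrite !mxE; ring.
  apply: le_lt_trans (enormD _ _) _; rewrite enormN.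
  by have := He _ cv; have := He _ cz; lra.
rewrite enormZ gtr0_norm // mulrC -ltr_pdivlMr // => /ltW /le_trans; apply.
have -> : 2 * e / t = 4 * D / r * e by rewrite /t; field; rewrite !gt_eqF.
exact: lexx.
Qed.

Lemma expr_unbounded (M : R) : exists n, M < lam ^+ n.
Proof.
have l1 := lam_gt1 hphi.
have bern n : 1 + n%:R * (lam - 1) <= lam ^+ n.
  elim: n => [|n IH]; first by rewrite mul0r addr0 expr0.
  rewrite exprS -natr1.
  have n0 : 0 <= n%:R :> R by [].
  have : lam * (1 + n%:R * (lam - 1)) <= lam * lam ^+ n.
    by rewrite ler_wpM2l // (ltW (lam_gt0 hphi)).
  apply: le_trans; rewrite -subr_ge0.
  have -> : lam * (1 + n%:R * (lam - 1)) - (1 + (n%:R + 1) * (lam - 1)) =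
    n%:R * (lam - 1) ^+ 2 by ring.
  by rewrite mulr_ge0 // sqr_ge0.
exists (Num.truncn (M / (lam - 1))).+1; apply: lt_le_trans (bern _).
have := truncnS_gt (M / (lam - 1)); rewrite ltr_pdivrMr ?subr_gt0 //; lra.
Qed.

Lemma Oeps_sub_Oj : exists2 eps0 : R, 0 < eps0 & forall eps x, eps <= eps0 -> X x ->
  exists2 j, A j & Oeps A phi eps x `<=` Oj A j x.
Proof.
have l1 := lam_gt1 hphi; have l0 := lam_gt0 hphi.
have [d0 d00 Hd] := close_motions_eq; have [K K0 HK] := rotation_displacement.
(* Makes [K * d + lam * d + d < d0], the tolerance needed in the induction for [disp]. *)
pose d := d0 / (K + lam + 2).
have den : 0 < K + lam + 2 by lra.
have dp : 0 < d by rewrite divr_gt0.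
have dE : (K * d + lam * d) + d < d0.
  have : (K + lam + 2) * d = d0 by rewrite /d mulrC divfK // gt_eqF.
  lra.
have [eps0 eps00 Heps] := tile_close hA dp.
exists eps0 => // eps x ee Xx; have xt := Xphi_tiling Xx.
have [c xc c0] := tiling_cover 0 xt; have tc := tiling_tile xt xc.
have [j jc] := tc; exists j; first by case: jc.
apply: smallest_sub; first exact: Oj_SO.
move=> r [Sr [t [_ Hlt Hcvg]]]; set y := TP (r, t) x in Hlt Hcvg.
have Gr : GE ((r, t) : motion R m) by [].
have Xy : X y by exact: Xphi_TP.
have yt := Xphi_tiling Xy.
have Hlt0 n : (tdist (iter n phi y) (iter n phi x) < eps0%:E)%E.
  by apply: lt_le_trans (Hlt n) _; rewrite lee_fin.
have [g [Gg yg gd]] := Heps _ _ _ xt yt (Hlt0 0%N) xc c0.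
have hc := tile_patch hphi tc.
(* At each level a tile of the supertile containing the origin is followed: the displacement of 0 is
   the translation part of the motion. *)
have /choice [c_ Hc] : forall n, exists b, iter n phi [set c] b /\ b 0.
  move=> n; have [_ [|b ? ?]] := iter_union hphi n 0 hc; last by exists b.
  by exists c; rewrite ?scaler0.
have tcn n : is_tile A (c_ n) by exact: patch_tile (iter_patch hphi n hc) (Hc n).1.
have xcn n : iter n phi x (c_ n).
  by apply: (iter_mono hphi (tiling_patch xt) _ (Hc n).1) => _ ->.
have ycn n : iter n phi y (Tt (conj_dil (lam ^+ n) g) (c_ n)).
  apply: (iter_mono hphi (tiling_patch yt) (P := [set Tt g c]));
    first by move=> _ ->.
  by rewrite (iter_Tt hphi) //; exists (c_ n) => //; exact: (Hc n).1.
have xnt n : tiling A (iter n phi x) by exact: (iter_tiling hphi).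
have ynt n : tiling A (iter n phi y) by exact: (iter_tiling hphi).
(* From the bound [d] at level [n], the dilated motion displaces the next tile by less than
   [K * d + lam * d]. This is small enough to identify it with the motion [h] supplied by closeness,
   whose displacement is below [d]: the loss is recovered at each level. *)
have disp n p : c_ n p -> enorm (move (conj_dil (lam ^+ n) g) p - p) < d.
  elim: n p => [|n IH] p cnp.
    have E : c_ 0%N = c by have [] := Hc 0%N.
    by rewrite expr0 conj_dil1; apply: gd; rewrite -E.
  have un : enorm (lam ^+ n *: g.2) < d.
    by have := IH 0 (Hc n).2; rewrite /move mulmx0 add0r subr0.
  have [h [Gh yh hd]] := Heps _ _ _ (xnt n.+1) (ynt n.+1) (Hlt0 n.+1) (xcn
    n.+1) (Hc n.+1).2.
  have -> : conj_dil (lam ^+ n.+1) g = h; last exact: hd.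
  apply: (Hd _ _ _ _ (K * d + lam * d) d (ynt n.+1) (tcn n.+1)) => //.
  move=> q cq; rewrite /move /= addrAC; apply: le_lt_trans (enormD _ _) _.
  apply: ler_ltD; first by apply: (HK c g d tc gd (c_ n.+1)) => //;
    exact: (Hc n.+1).2.
  by rewrite exprS -scalerA enormZ gtr0_norm // ltr_pM2l.
have g2 : g.2 = 0.
  apply: enorm0_eq0; apply/eqP; rewrite eq_le enorm_ge0 andbT leNgt;
    apply/negP => u0.
  have [n Hn] := expr_unbounded (d / enorm g.2).
  have := disp n 0 (Hc n).2; rewrite /move mulmx0 add0r subr0 /= enormZ.
  rewrite gtr0_norm ?(lamX_gt0 hphi) //; apply/negP; rewrite -leNgt ltW //.
  by rewrite -ltr_pdivrMr.
(* Dilation leaves the rotation unchanged, so one level at which the tilings are very close bounds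
   the rotation of [g] itself. *)
have sp p (e : R) : 0 < e -> c p -> enorm (g.1 *m p - p) <= K * e.
  move=> e0 cp; pose e' := Num.min e d.
  have e'0 : 0 < e' by rewrite lt_min e0 dp.
  have [eps1 eps10 Heps1] := tile_close hA e'0.
  have [n Hn] : exists n, (tdist (iter n phi y) (iter n phi x) < eps1%:E)%E.
    have : nbhs (0%E : \bar R) [set z | (z < eps1%:E)%E].
      by apply: open_nbhs_nbhs; split;
        [exact: open_ereal_lt_ereal|rewrite /= lte_fin].
    by move/Hcvg => [N _ HN]; exists N; apply: HN => /=.
  have [h [Gh yh hd]] := Heps1 _ _ _ (xnt n) (ynt n) Hn (xcn n) (Hc n).2.
  have E : conj_dil (lam ^+ n) g = h.
    apply: (Hd _ _ _ _ d e' (ynt n) (tcn n)) => //; last exact: disp.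
    have : e' <= d by rewrite ge_min lexx orbT.
    have : 0 < K * d by rewrite mulr_gt0.
    have : d < lam * d by rewrite ltr_pMl.
    lra.
  apply: (@le_trans _ _ (K * e'));
    last by rewrite ler_wpM2l ?(ltW K0) // ge_min lexx.
  rewrite -[g.1]/((conj_dil (lam ^+ n) g).1) E.
  exact: (HK _ _ _ (tcn n) hd c p tc c0 cp).
have gp p : c p -> move g p = p.
  move=> cp; rewrite /move g2 addr0; apply/eqP; rewrite -subr_eq0;
    apply/eqP/enorm0_eq0.
  apply/eqP; rewrite eq_le enorm_ge0 andbT leNgt; apply/negP => H.
  have := sp p (enorm (g.1 *m p - p) / (2 * K)) _ cp.
  rewrite divr_gt0 ?mulr_gt0 // => /(_ isT).
  have -> : K * (enorm (g.1 *m p - p) / (2 * K)) = enorm (g.1 *m p - p) / 2.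
    by field; rewrite gt_eqF.
  lra.
have gc : Tt g c = c.
  by apply/seteqP; split=> p => [[q cq <-]|cp]; [rewrite gp|exists p => //;
    exact: gp].
move: yg; rewrite gc => -[b xb bc].
apply: (@Oj_mem _ _ _ _ _ (r, t) c b) => //.
have -> : b = Tt (ginv (r, t)) c by rewrite -bc TtK.
by apply: has_type_Tt => //; exact: GE_inv.
Qed.

End Contraction.

(** * Points covered by high-level supertiles *)

Section GridCounting.
Variables (m n : nat).
Local Notation grid := {ffun 'I_m -> 'I_n}.

(** [S] has at most one point on each line in direction [l], and each line has [n] points. *)
Lemma transversal_count (S : pred grid) (l : 'I_m) :
  (forall f g, S f -> S g -> (forall i, i != l -> f i = g i) -> f = g) ->
  (#|S| * n <= #|{: grid}|)%N.
Proof.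
move=> inj; pose F (z : grid * 'I_n) : grid := [ffun j =>
  if j == l then z.2 else z.1 j].
have -> : (#|S| * n = #|[predX S & 'I_n]|)%N by rewrite cardX card_ord.
rewrite -(@card_in_image _ _ F); first exact: max_card.
move=> [f i] [g j]; rewrite !inE /= !andbT => Sf Sg /ffunP E.
have ij : i = j by have := E l; rewrite !ffunE eqxx.
rewrite ij; congr pair; apply: inj => // k /negPf kl.
by have := E k; rewrite !ffunE kl.
Qed.

Lemma has_count (T : Type) (s : seq T) (S : T -> pred grid) (M : nat) :
  (forall z, (List.In z s) -> (#|S z| * n <= M)%N) ->
  (#|[pred f | has (S^~ f) s]| * n <= size s * M)%N.
Proof.
elim: s => [|z s IH] H; first by rewrite eq_card0.
have -> : #|[pred f | has (S^~ f) (z ::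
  s)]| = #|[predU S z & [pred f | has (S^~ f) s]]|.
  by apply: eq_card => f; rewrite !inE.
apply: (@leq_trans ((#|S z| + #|[pred f | has (S^~ f) s]|) * n)).
  by rewrite leq_mul2r -cardUI leq_addr orbT.
rewrite mulnDl /= mulSn leq_add //; first by apply: H; left.
by apply: IH => y ys; apply: H; right.
Qed.

End GridCounting.

Section NullSet.
Context {R : realType} {m : nat}.
Variables (A : set (set 'cV[R]_m)) (faces : set 'cV[R]_m -> set (set 'cV[R]_m)).
Hypothesis hA : alphabet A faces.
Variables (phi : set (set 'cV[R]_m) -> set (set 'cV[R]_m)) (lam : R).
Hypothesis hphi : substitution A faces phi lam.
Implicit Types (p q t u : 'cV[R]_m) (g h : motion R m) (a b c : set 'cV[R]_m).
Implicit Types (x y P Q : set (set 'cV[R]_m)).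
Local Notation X := (Xphi A phi).

Lemma glim_conj_dil (U : set_system nat) (UU : UltraFilter U)
    (h_ : nat -> motion R m) h (l : R) : 0 < l ->
  glim U h_ h -> glim U (fun i => conj_dil l (h_ i)) (conj_dil l h).
Proof.
move=> l0 hl r e e0; have PU := ultra_filter_proper UU.
have el : 0 < e / l by rewrite divr_gt0.
apply: filterS (hl (r / l) _ el) => i H p pr.
have E k : move (conj_dil l k) p = l *: move k (l^-1 *: p).
  by rewrite /move /= scalerDr -scalemxAr scalerA divff ?gt_eqF // scale1r.
rewrite !E -scalerBr enormZ gtr0_norm // mulrC -ltr_pdivlMr //; apply: H.
by rewrite enormZ gtr0_norm ?invr_gt0 // mulrC ler_pM2r ?invr_gt0.
Qed.

(* The supertile is any patch of x, not necessarily one of a supertiling of x: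
   this makes the set open. *)
Definition uncovered (rho : R) (k : nat) (t : 'cV[R]_m) : set (set (set 'cV[R]_m)) :=
  [set x | X x /\ ~ exists a, [/\ is_tile A a, iter k phi [set a] `<=` x &
     forall p, enorm (p - t) <= rho -> a ((lam ^+ k)^-1 *: p)]].

(** Covered tilings form a closed set: tiles [a] for tilings tending to [x] all contain the
    contracted centre [t], hence converge along the ultrafilter, and the supertile of the limit is
    in [x]. *)
Lemma uncovered_open rho k t : 0 <= rho -> Xphi_open A phi (uncovered rho k t).
Proof.
move=> r0; split; first by move=> x [].
move=> x [Xx nx]; apply: contrapT => nex; apply: nx.
have xt := Xphi_tiling Xx; have l0 := lamX_gt0 hphi k.
have ex (i : nat) : exists z : set (set 'cV[R]_m) * set 'cV[R]_m,
    [/\ X z.1, (tdist x z.1 < (i.+1%:R^-1)%:E)%E, is_tile A z.2,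
      iter k phi [set z.2] `<=` z.1 &
     forall p, enorm (p - t) <= rho -> z.2 ((lam ^+ k)^-1 *: p)].
  apply: contrapT => nz; apply: nex; exists i.+1%:R^-1;
    first by rewrite invr_gt0 ltr0n.
  move=> y Xy xy; split=> // -[a [ta ay Ha]]; apply: nz; exists (y, a); split=> //.
have [z Hz] := choice ex => {ex nex}.
have tz i : is_tile A (z i).2 by have [] := Hz i.
have pz i p : enorm (p - t) <= rho -> (z i).2 ((lam ^+ k)^-1 *: p).
  by have [_ _ _ _] := Hz i; apply.
have t0 i : (z i).2 ((lam ^+ k)^-1 *: t) by apply: pz; rewrite subrr enorm0.
have [U UU Un] := free_ultrafilter; have PU := ultra_filter_proper UU.
have [a [h_ [h [Aa Gh_ Gh hl aE]]]] := ulim_tile hA UU tz t0.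
have ta := alphabet_tile Aa.
exists (Tt h a); split; first exact: tile_Tt.
- rewrite (iter_Tt hphi) // => _ [b ab <-].
  have tb := patch_tile (iter_patch hphi k (tile_patch hphi ta)) ab.
  apply: (ulim_tile_in hA UU xt (y_ := fun i => (z i).1) (k_ := fun i =>
    conj_dil (lam ^+ k) (h_ i))) => //.
  + by move=> i; have [/Xphi_tiling] := Hz i.
  + move=> e e0; have : U [set i | ((Num.truncn e^-1).+1 <= i)%N] by exact: Un.
    apply: filterS => i /= ie; have [_ H _ _ _] := Hz i.
    rewrite tdistC; apply: (lt_le_trans H); rewrite lee_fin -[leRHS]invrK.
    rewrite lef_pV2 ?posrE ?ltr0n ?invr_gt0 //.
    apply/ltW/(lt_le_trans (truncnS_gt _)); rewrite ler_nat;
      exact: leq_trans (leqnSn i).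
  + exact: (glim_conj_dil UU).
  + apply: filterS aE => i zE; have [_ _ _ H _] := Hz i; apply: H.
    by rewrite zE (iter_Tt hphi) //; exists b.
- move=> p pt; apply: (ulim_tile_mem hA UU ta Gh hl).
  by apply: filterS aE => i <-; exact: pz.
Qed.

Lemma uncovered_TP rho k t s :
  TP (1%:M, s) @` uncovered rho k t = uncovered rho k (t + s).
Proof.
have sub t1 s1 : TP (1%:M, s1) @` uncovered rho k t1 `<=` uncovered rho k (t1 + s1).
  have G1 : GE ((1%:M, s1) : motion R m) by exact: SO_1.
  move=> _ [x [Xx nx] <-]; split; first exact: Xphi_TP.
  move=> [a [ta ax Ha]]; apply: nx.
  have l0 := lamX_gt0 hphi k.
  have G2 : GE ((1%:M, - ((lam ^+ k)^-1 *: s1)) : motion R m) by exact: SO_1.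
  exists (Tt (1%:M, - ((lam ^+ k)^-1 *: s1)) a); split; first exact: tile_Tt.
  - rewrite (iter_Tt hphi) // -(TPK x G1) /ginv /=.
    rewrite trmx1 mul1mx /conj_dil /= scalerN scalerA divff ?gt_eqF // scale1r.
    exact: TP_subset.
  - move=> p pt; exists ((lam ^+ k)^-1 *: (p + s1)).
      by apply: Ha; rewrite opprD addrACA subrr addr0.
    by rewrite /move /= mul1mx scalerDr addrK.
apply/seteqP; split; first exact: sub.
move=> x xu; exists (TP (1%:M, - s) x).
  by rewrite -[t](addrK s); apply: sub; exists x.
rewrite TP_mul /gmul /= !mul1mx addNr; exact: TP_id.
Qed.

(** * Uncovered grid points lie near few hyperplanes *)

Definition grid_point (n : nat) (e : R) (f : {ffun 'I_m -> 'I_n}) : 'cV[R]_m :=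
  \col_i ((f i)%:R * e).

Lemma grid_point_le n e f : 0 <= e -> enorm (@grid_point n e f) <= (m * n)%:R * e.
Proof.
move=> e0; apply: le_trans (enorm_le_sum _) _.
apply: (@le_trans _ _ (\sum_(i < m) n%:R * e)).
  apply: ler_sum => i _; rewrite mxE ger0_norm ?mulr_ge0 // ler_wpM2r // ler_nat.
  exact/ltnW/ltn_ord.
by rewrite sumr_const card_ord natrM -mulrA -[leLHS]mulr_natl.
Qed.

(** Let [l] be the coordinate where [u] is largest, so that [enorm u] is at most [m] times [u l 0]
    in absolute value. With this mesh, two grid points on a line in direction [l] are too far apart
    to be in the same slab. *)
Lemma slab_count n (rho : R) u (c : R) : 0 <= rho -> u != 0 ->
  (#|[pred f : {ffun 'I_m -> 'I_n} |
      `|dot u (grid_point (2 * m%:R * rho + 1) f) - c| <= enorm u * rho]%R| * n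
   <= #|{: {ffun 'I_m -> 'I_n}}|)%N.
Proof.
move=> r0 u0; set e := 2 * m%:R * rho + 1.
have e0 : 0 < e by rewrite ltr_wpDl // !mulr_ge0.
have [i0 _] : exists i0 : 'I_m, true.
  apply: contrapT => nm; move/eqP: u0; apply; apply/colP => i; exfalso; apply: nm.
  by exists i.
have en0 : enum 'I_m != [::].
  by apply/eqP => E; have := mem_enum 'I_m i0; rewrite E.
have [l _ lmax] := seq_argmax (fun i => `|u i 0|) en0.
have um : enorm u <= m%:R * `|u l 0|.
  apply: le_trans (enorm_le_sum _) _.
  apply: (@le_trans _ _ (\sum_(i < m) `|u l 0|)).
    by apply: ler_sum => i _; apply: lmax; rewrite mem_enum.
  by rewrite sumr_const card_ord mulr_natl.
have ul : 0 < `|u l 0|.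
  rewrite normr_gt0; apply: contra_neq u0 => ul; apply: enorm0_eq0.
  by apply/eqP; rewrite eq_le enorm_ge0 andbT; move: um; rewrite ul normr0 mulr0.
apply: (transversal_count (l := l)) => f g Sf Sg fg.
move: Sf Sg; rewrite !inE => Hf Hg.
apply/ffunP => i; have [->|il] := eqVneq i l; last exact: fg.
apply: contrapT => /eqP nfg.
have : `|dot u (grid_point e f) - dot u (grid_point e g)| <= 2 * (enorm u * rho).
  rewrite -(subrKA c); apply: le_trans (ler_normD _ _) _.
  rewrite -[X in _ + X]normrN opprB.
  by apply: le_trans (lerD Hf Hg) _; rewrite [leRHS]mulr_natl mulr2n.
have -> : dot u (grid_point e f) - dot u (grid_point e g) =
    u l 0 * (((f l)%:R - (g l)%:R) * e).
  rewrite -dotNr -dotDr /dot (bigD1 l) //= big1 ?addr0.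
    by rewrite !mxE mulrBl.
  by move=> j jl; rewrite !mxE fg // subrr mulr0.
rewrite !normrM (gtr0_norm e0).
have : 1 <= `|(f l)%:R - (g l)%:R : R|.
  have [lt|lt|/val_inj E] := ltngtP (f l) (g l); last by rewrite E eqxx in nfg.
    rewrite distrC ger0_norm; last by rewrite subr_ge0 ler_nat ltnW.
    by rewrite lerBrDr addrC natr1 ler_nat.
  rewrite ger0_norm; last by rewrite subr_ge0 ler_nat ltnW.
  by rewrite lerBrDr addrC natr1 ler_nat.
move=> H1 H2.
have H3 : `|u l 0| * e <= `|u l 0| * (`|(f l)%:R - (g l)%:R| * e).
  by rewrite ler_wpM2l // -[leLHS]mul1r ler_wpM2r // ltW.
have H4 : 2 * (enorm u * rho) <= `|u l 0| * (2 * m%:R * rho).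
  have -> : `|u l 0| * (2 * m%:R * rho) = 2 * ((m%:R * `|u l 0|) * rho) by ring.
  by rewrite ler_wpM2l // ler_wpM2r.
have : `|u l 0| * e <= `|u l 0| * (2 * m%:R * rho) by lra.
by rewrite ler_pM2l // /e; lra.
Qed.

(** If [t] is uncovered, the tile of the preimage at the contracted [t] has a boundary point close
    by, so [t] is within [rho] of a dilated hyperplane. The net and the faces bound the number of
    hyperplanes independently of [rho] and [n]. *)
Lemma uncovered_count : exists K : nat, forall (rho : R) n, 0 <= rho ->
  exists k, forall x,
  (#|[pred f : {ffun 'I_m -> 'I_n} |
      `[< uncovered rho k (grid_point (2 * m%:R * rho + 1) f) x >]]| * n
   <= K * #|{: {ffun 'I_m -> 'I_n}}|)%N.
Proof.
have [net Hnet] := tile_net hA 1.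
have [k2 Hk2] := tile_hyperplanes hA.
exists (size net * k2)%N => rho n r0.
set e := 2 * m%:R * rho + 1.
have e0 : 0 < e by rewrite ltr_wpDl // !mulr_ge0.
(* At this level the contracted grid fits in the unit ball, the one for which the net was taken. *)
have [k Hk] := expr_unbounded hphi ((m * n)%:R * e).
exists k => x; have [Xx|nXx] := pselect (X x); last first.
  rewrite eq_card0 // => f; rewrite !inE; apply/negP => /asboolP [Xx _].
  exact: nXx.
have lk := lamX_gt0 hphi k.
have [x' Xx' xE] := Xphi_surj_iter hA hphi k Xx.
have x't := Xphi_tiling Xx'.
(* The hyperplanes of the only tile of [x'] with [q] in its interior, or the empty list if there is
   none. *)
have /choice [Lq HL] : forall q, exists s : seq ('cV[R]_m * R), [/\ (size s <= k2)%N,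
    (forall uc, uc \in s -> uc.1 != 0) &
    forall a p, x' a -> a° q -> bnd a p -> exists2 uc, uc \in s & dot uc.1 p = uc.2].
  move=> q; have [[a [xa aq]]|na] := pselect (exists a, x' a /\ a° q).
    have [s [s1 s2 s3]] := Hk2 a (tiling_tile x't xa); exists s;
      split=> // b p xb bq.
    suff -> : b = a by exact: s3.
    exact: (tiling_eq hA x't xb xa bq (interior_subset aq)).
  by exists [::]; split=> // a p xa aq; case: na; exists a.
pose H := flatten [seq Lq q | q <- net].
pose S (uc : 'cV[R]_m * R) : pred {ffun 'I_m -> 'I_n} :=
  [pred f | `|dot uc.1 (grid_point e f) - lam ^+ k * uc.2| <= enorm uc.1 * rho].
have HS : (size H <= size net * k2)%N.
  rewrite /H; elim: (net) => [//|q s IH] /=.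
  by rewrite size_cat mulSn leq_add //; case: (HL q).
have H0 uc : List.In uc H -> uc.1 != 0.
  move=> ucH; have : uc \in H.
    elim: (H) ucH => [//|z s IH] /= [->|/IH us]; first exact: mem_head.
    by rewrite inE us orbT.
  by move=> /flattenP [_ /mapP [q _ ->]]; case: (HL q) => _ + _; apply.
apply: (@leq_trans (#|[pred f | has (S^~ f) H]| * n)); last first.
  apply: (leq_trans (has_count (M := #|{: {ffun 'I_m -> 'I_n}}|) _)).
    by move=> uc /H0 u0; exact: slab_count.
  by rewrite leq_mul2r HS orbT.
rewrite leq_mul2r; apply/orP; right; apply: subset_leq_card;
  apply/fintype.subsetP => f.
rewrite !inE => -[_ nf].
set t := grid_point e f in nf *.
have [a xa at_] := tiling_cover ((lam ^+ k)^-1 *: t) x't.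
have ta := tiling_tile x't xa.
have t1 : enorm ((lam ^+ k)^-1 *: t) <= 1.
  rewrite enormZ gtr0_norm ?invr_gt0 // mulrC ler_pdivrMr // mul1r.
  by apply: le_trans (ltW Hk); apply: grid_point_le; exact: ltW.
have [q qnet aq] := Hnet a _ ta at_ t1.
have [p [pt ap]] : exists p, enorm (p - t) <= rho /\ ~ a ((lam ^+ k)^-1 *: p).
  apply: contrapT => np; apply: nf; exists a; split=> //.
    rewrite xE; apply: (iter_mono hphi (tiling_patch x't)) => _ ->; exact: xa.
  by move=> p pt; apply: contrapT => nap; apply: np; exists p.
have [z [bz zt]] := segment_meets_bnd at_ ap.
have [_ _ /(_ a z xa aq bz) [uc ucL ucz]] := HL q.
apply/hasP; exists uc; first by apply/flattenP; exists (Lq q) => //; apply: map_f.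
rewrite /S /= -ucz -dotZr -dotNr -dotDr.
have zt' : enorm (t - lam ^+ k *: z) <= rho.
  apply: le_trans pt; rewrite (enormB t).
  have -> : lam ^+ k *: z - t = lam ^+ k *: (z - (lam ^+ k)^-1 *: t).
    by rewrite scalerBr scalerA divff ?gt_eqF // scale1r.
  rewrite enormZ gtr0_norm // mulrC -ler_pdivlMr //; apply: le_trans zt _.
  by rewrite -scalerBr enormZ gtr0_norm ?invr_gt0 // mulrC.
have u0 := enorm_ge0 uc.1.
rewrite ler_norml; apply/andP; split.
  rewrite lerNl -dotNr; apply: le_trans (cauchy_schwarz _ _) _.
  by rewrite enormN ler_wpM2l.
by apply: le_trans (cauchy_schwarz _ _) _; rewrite ler_wpM2l.
Qed.

Lemma uncovered_measurable rho k t : 0 <= rho ->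
  (Xphi_open A phi).-sigma.-measurable (uncovered rho k t).
Proof. by move=> r0; apply: sub_sigma_algebra; exact: uncovered_open. Qed.

(** * Averaging an invariant measure over the grid *)

Section Averaging.
Variable mu : probability (g_sigma_algebraType (Xphi_open A phi)) R.
Hypothesis hmu : invariant_measure mu.

Lemma uncovered_mu rho k t : 0 <= rho ->
  mu (uncovered rho k t) = mu (uncovered rho k 0).
Proof.
move=> r0; have [_ inv] := hmu.
rewrite -[RHS](inv t); last exact: uncovered_measurable.
by rewrite uncovered_TP add0r.
Qed.

(** By invariance all grid points have the same probability of being uncovered; the integral of the
    number of uncovered ones is bounded pointwise by [uncovered_count]. *)
Lemma uncovered_small : exists K : nat, forall (rho : R) n, 0 <= rho -> (0 < n)%N ->
  exists k, (mu (uncovered rho k 0) <= (K%:R / n%:R)%:E)%E.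
Proof.
have [K HK] := uncovered_count.
exists K => rho n r0 n0; have [k Hk] := HK rho n r0; exists k.
set e := 2 * m%:R * rho + 1 in Hk.
pose grid := {ffun 'I_m -> 'I_n}.
pose F (f : grid) := uncovered rho k (grid_point e f).
have mF f : measurable (F f : set (g_sigma_algebraType (Xphi_open A phi))).
  exact: uncovered_measurable.
have nR : 0 < n%:R :> R by rewrite ltr0n.
have gR : 0 < #|{: grid}|%:R :> R.
  by rewrite ltr0n card_ffun card_ord expn_gt0 n0.
pose I f (x : g_sigma_algebraType (Xphi_open A phi)) : \bar R := (\1_(F f) x : R)%:E.
have mI f : measurable_fun setT (I f).
  by apply/measurable_EFinP; exact: measurable_indic.
have E : (\int[mu]_x (\sum_(f : grid) I f x) = #|{:
  grid}|%:R%:E * mu (uncovered rho k 0%R))%E.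
  rewrite ge0_integral_sum //; last by move=> f x _; rewrite /I lee_fin indicE.
  rewrite (eq_bigr (fun=> mu (uncovered rho k 0))) => [|f _]; last first.
    by rewrite /I integral_indic // setIT; exact: uncovered_mu.
  rewrite -(fineK (fin_num_measure mu _ (uncovered_measurable k 0 r0))) sumEFin.
  by rewrite sumr_const -EFinM mulr_natl.
have : (\int[mu]_x (\sum_(f : grid) I f x) <= ((K * #|{: grid}|)%:R / n%:R)%:E)%E.
  rewrite -[leRHS]mule1 -(probability_setT mu) -integral_cst //.
  apply: ge0_le_integral => //.
  - by move=> x _; apply: sume_ge0 => f _; rewrite lee_fin indicE.
  - exact: emeasurable_sum.
  move=> x _; rewrite sumEFin lee_fin ler_pdivlMr //.
  have -> : \sum_(f : grid) \1_(F f) x = #|[pred f : grid | `[< F f x >]]|%:R :> R.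
    rewrite -sum1_card natr_sum [RHS]big_mkcond; apply: eq_bigr => f _.
    rewrite indicE inE; case: asboolP => H; first by rewrite mem_set.
    by rewrite memNset.
  by rewrite -natrM ler_nat; exact: Hk.
rewrite E -(fineK (fin_num_measure mu _ (uncovered_measurable k 0 r0))) -EFinM
  !lee_fin.
by rewrite natrM mulrC mulrAC ler_pM2r.
Qed.

End Averaging.

Lemma uncovered_null rho : 0 <= rho ->
  Defs.null_set A phi (\bigcap_k uncovered rho k 0).
Proof.
move=> r0.
have mk k : measurable (uncovered rho k 0 :
  set (g_sigma_algebraType (Xphi_open A phi))).
  exact: uncovered_measurable.
have mN : (Xphi_open A phi).-sigma.-measurable (\bigcap_k uncovered rho k 0).
  exact: bigcapT_measurable mk.
split=> // mu hmu; have [K HK] := uncovered_small hmu.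
have fmu := fin_num_measure mu _ mN.
apply/eqP; rewrite eq_le measure_ge0 andbT -(fineK fmu) lee_fin leNgt;
  apply/negP => v0.
set v := fine _ in v0 *.
pose n := (Num.truncn (K%:R / v)).+1.
have [k Hk] := HK rho n r0 isT.
have : (mu (\bigcap_k uncovered rho k 0) <= (K%:R / n%:R)%:E)%E.
  apply: le_trans Hk; apply: le_measure; rewrite ?inE //; exact: bigcap_inf.
rewrite -(fineK fmu) lee_fin -/v leNgt => /negP; apply.
by rewrite ltr_pdivrMr ?ltr0n // mulrC -ltr_pdivrMr // truncnS_gt.
Qed.

End NullSet.

Theorem theorem2 (R : realType) (m : nat)
    (A : set (set 'cV[R]_m)) (faces : set 'cV[R]_m -> set (set 'cV[R]_m))
    (phi : set (set 'cV[R]_m) -> set (set 'cV[R]_m)) (lam : R)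
    (hA : alphabet A faces) (hphi : substitution A faces phi lam)
    (hcomp : unique_composition A phi) :
  (exists2 eps0 : R, 0 < eps0 &
     forall eps : R, 0 < eps < eps0 ->
       almost_every A phi (fun x =>
         (forall j, A j -> c_equiv (Oeps A phi eps x) (Oj A j x)) /\
         (self_parallel A phi ->
            forall j, A j -> Oeps A phi eps x = Oj A j x))) /\
  (forall j, A j -> forall x y, Xphi A phi x -> Xphi A phi y ->
     SO_conj (Oj A j x) (Oj A j y)).
Proof.
split; last by move=> j Aj x y Xx Xy; exact: (Oj_conj hA hphi).
have [eps0 eps00 upper] := Oeps_sub_Oj hA hphi.
exists eps0 => // eps /andP[e0 ee].
have [rho0 lower] := Oj_sub_Oeps hA hphi e0.
pose rho := Num.max rho0 0.
have r0 : 0 <= rho by rewrite le_max lexx orbT.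
exists (\bigcap_k uncovered A phi lam rho k 0);
  first exact: (uncovered_null hA hphi).
move=> x Xx nx.
have [j0 Aj0 Osub] := upper eps x (ltW ee) Xx.
have [k [a [ta ax Ha]]] : exists k a, [/\ is_tile A a, iter k phi [set a] `<=` x &
    forall p, enorm (p - 0) <= rho -> a ((lam ^+ k)^-1 *: p)].
  by apply: contrapT => nk; apply: nx => k _; split=> // -[a Ha]; apply: nk;
    exists k, a.
have [x' Xx' xE] := Xphi_surj_iter hA hphi k Xx.
have [i ia] := ta; have Ai : A i by case: ia.
have sub : Oj A i x' `<=` Oeps A phi eps x.
  rewrite xE; apply: (lower k x' i a Xx' ia); first by rewrite -xE.
  move=> p pr; apply/(iter_union hphi _ _ (tile_patch hphi ta)); exists a => //.
  by apply: Ha; rewrite subr0 le_max pr.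
have sO : SO_subgroup (Oeps A phi eps x) by apply: SO_gen_subgroup => r [].
split=> [j Aj|sp j Aj]; last first.
  apply/seteqP; split; last first.
    by rewrite xE (Oj_self_parallel_eq hA hphi k sp Xx' Aj Ai) -xE.
  by rewrite -(Oj_self_parallel_eq hA hphi 0 sp Xx Aj0 Aj).
(* Each half exchanges a type for a level: [j0] in the preimage [x1] becomes [j] in [x], and [j] in
   the preimage [x2] of [x'] becomes [i] in [x']. The conjugations come from replacing [x] by [x1]
   and by [x2]. *)
split.
- have [x1 Xx1 x1E] := Xphi_surj hA hphi Xx.
  have [r Sr rE] := Oj_conj hA hphi Xx Xx1 Aj0.
  exists (SO_conjugate r (Oeps A phi eps x)); split.
  + exact: SO_conjugate_subgroup.
  + apply: (@subset_trans _ (Oj A j0 x1)); first by rewrite rE; exact: image_subset.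
    by rewrite x1E; apply: (Oj_phi hphi Xx1 Aj Aj0).
  + by exists r.
- have [x2 Xx2 x2E] := Xphi_surj hA hphi Xx'.
  exists (Oj A j x2); split; first exact: Oj_SO.
    by apply: (subset_trans _ sub); rewrite x2E; exact: (Oj_phi hphi).
  exact: (Oj_conj hA hphi).
Qed.
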